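(* Let $c_\beta\in(0,1]$ and $c_\eta,c_B>0$. There is a constant $C$ depending only on $L,\sigma,\Delta_f,c_\beta,c_\eta,c_B$ such that the following holds. Suppose Assumptions (D2), (D3), (D4) hold, $T\ge n^2$, and Dis-Lion-VR is run with $B_0=\lceil c_Bn^{-2/3}T^{1/3}\rceil$ (and $B_0\ge1$), $\beta_2=c_\beta n^{1/3}T^{-2/3}$, $0<\beta_1\le\sqrt{\beta_2}$, $\eta=c_\eta n^{1/3}d^{-1/2}T^{-2/3}$, $0\le\lambda\le\frac1{2\eta T}$ and $\|\mathbf{x}_1\|_\infty\le\eta$. Then $$\frac1T\sum_{t=1}^T\mathbb{E}\left[\|\nabla f(\mathbf{x}_t)\|_1\right]\le C\,\frac{d^{1/2}}{n^{1/3}T^{1/3}}.$$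
   Context: Distributed setting: $n$ nodes; $f(\mathbf{x})=\frac1n\sum_{j=1}^nf_j(\mathbf{x})$ with $f_j(\mathbf{x})=\mathbb{E}_{\xi^j\sim\mathcal{D}_j}[f_j(\mathbf{x};\xi^j)]$, where the $\mathcal{D}_j$ may differ. Node $j$ draws samples $\xi^j\sim\mathcal{D}_j$, independent across nodes and time and of everything before, and for a drawn sample can evaluate $\nabla f_j(\cdot;\xi^j)$ at several points. $\|\cdot\|$ is the Euclidean norm, $\|\cdot\|_1,\|\cdot\|_\infty$ the $\ell_1$- and max-norms; $\operatorname{sign}$ acts coordinatewise with values in $\{-1,0,1\}$. (D2) $\mathbb{E}_\xi\|\nabla f_j(\mathbf{x};\xi)-\nabla f_j(\mathbf{y};\xi)\|^2\le L^2\|\mathbf{x}-\mathbf{y}\|^2$ for all $j,\mathbf{x},\mathbf{y}$. (D3) $\mathbb{E}_{\xi}[\nabla f_j(\mathbf{x};\xi)]=\nabla f_j(\mathbf{x})$ and $\mathbb{E}_\xi\|\nabla f_j(\mathbf{x};\xi)-\nabla f_j(\mathbf{x})\|^2\le\sigma^2$ for all $j,\mathbf{x}$. (D4) $f_*=\inf_{\mathbf{x}}f(\mathbf{x})>-\infty$ and $f(\mathbf{x}_1)-f_*\le\Delta_f$. Dis-Lion-VR: given $\mathbf{x}_1$, $\beta_1,\beta_2,\eta,\lambda,B_0$. At $t=1$ each node draws independent $\xi_1^{j,1},\dots,\xi_1^{j,B_0}$ and sets $\mathbf{v}_1^j=\mathbf{m}_1^j=\frac1{B_0}\sum_{i=1}^{B_0}\nabla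 f_j(\mathbf{x}_1;\xi_1^{j,i})$. For $t\ge2$ each node draws a fresh $\xi_t^j$ and sets, with $\mathbf{g}_t^j=\nabla f_j(\mathbf{x}_t;\xi_t^j)$ and $\mathbf{h}_t^j=\nabla f_j(\mathbf{x}_{t-1};\xi_t^j)$: $\mathbf{v}_t^j=(1-\beta_1)\mathbf{m}_{t-1}^j+\beta_1\mathbf{g}_t^j+(1-\beta_1)(\mathbf{g}_t^j-\mathbf{h}_t^j)$, $\mathbf{m}_t^j=(1-\beta_2)\mathbf{m}_{t-1}^j+\beta_2\mathbf{g}_t^j+(1-\beta_2)(\mathbf{g}_t^j-\mathbf{h}_t^j)$. The server forms $\mathbf{v}_t=\sum_{j=1}^n\mathbf{v}_t^j$ and all nodes update $\mathbf{x}_{t+1}=\mathbf{x}_t-\eta(\operatorname{sign}(\mathbf{v}_t)+\lambda\mathbf{x}_t)$. *)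

(* Defs.v *)
From mathcomp Require Import all_boot all_order all_algebra.
From mathcomp Require Import all_classical all_reals all_analysis.
Set Implicit Arguments. Unset Strict Implicit. Unset Printing Implicit Defensive.
Import Order.TTheory GRing.Theory Num.Theory.
Local Open Scope classical_set_scope.
Local Open Scope ring_scope.

Definition norm1 {R : realType} {d : nat} (v : 'rV[R]_d) : R :=
  \sum_(i < d) `|v ord0 i|.
Definition norm2 {R : realType} {d : nat} (v : 'rV[R]_d) : R :=
  Num.sqrt (\sum_(i < d) v ord0 i ^+ 2).
Definition normInf {R : realType} {d : nat} (v : 'rV[R]_d) : R :=
  \big[Num.max/0]_(i < d) `|v ord0 i|.

Definition sign_vec {R : realType} {d : nat} (v : 'rV[R]_d) : 'rV[R]_d :=
  \row_i Num.sg (v ord0 i).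

Definition grad {R : realType} {d : nat} (f : 'rV[R]_d -> R) (x : 'rV[R]_d)
  : 'rV[R]_d := \row_i ('D_(delta_mx ord0 i) f x : R).

Definition borel_vec (R : realType) (d : nat) : set (set 'rV[R]_d) :=
  <<s [set A : set 'rV[R]_d | open (A : set ('rV[R]_d : normedModType R))] >>.

Definition jointly_measurable {R : realType} {d : nat} {dX : measure_display}
  {Xi : measurableType dX} (F : 'rV[R]_d -> Xi -> R) : Prop :=
  forall B : set R, measurable B ->
    <<s [set Z : set ('rV[R]_d * Xi) |
          exists A C, @borel_vec R d A /\ measurable C /\ Z = A `*` C] >>
      ((fun p : 'rV[R]_d * Xi => F p.1 p.2) @^-1` B).

Definition mutually_independent {R : realType} {dO : measure_display}
  {Omega : measurableType dO} (P : probability Omega R) {I : eqType}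
  {dX : measure_display} {Xi : measurableType dX}
  (X : I -> Omega -> Xi) (S : set I) : Prop :=
  forall (F : seq I) (A : I -> set Xi),
    uniq F -> (forall k, k \in F -> S k) -> (forall k, measurable (A k)) ->
    P (\big[setI/setT]_(k <- F) (X k @^-1` A k)) =
    (\prod_(k <- F) P (X k @^-1` A k))%E.

(* Sample indices (t, j, i) actually drawn by Dis-Lion-VR:
   at t = 1, node j draws xi_1^{j,i} for i < B0 ;
   at t >= 2, node j draws a single xi_t^j, indexed (t, j, 0). *)
Definition used_index (n B0 : nat) (k : nat * 'I_n * nat) : Prop :=
  (k.1.1 = 1%N /\ (k.2 < B0)%N) \/ ((2 <= k.1.1)%N /\ k.2 = 0%N).

(* Dis-Lion-VR on a realization s of the samples.
   lion_state k = (x_{k+1}, x_{k+2}, (m_{k+1}^j)_j). *)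
Fixpoint lion_state {R : realType} {d n : nat} {Xi : Type}
  (G : 'I_n -> 'rV[R]_d -> Xi -> 'rV[R]_d) (s : nat -> 'I_n -> nat -> Xi)
  (x1 : 'rV[R]_d) (beta1 beta2 eta lambda : R) (B0 : nat) (k : nat)
  : 'rV[R]_d * 'rV[R]_d * ('I_n -> 'rV[R]_d) :=
  match k with
  | 0%N =>
      let m := fun j => (B0%:R)^-1 *: \sum_(i < B0) G j x1 (s 1%N j i) in
      let v := \sum_(j < n) m j in
      (x1, x1 - eta *: (sign_vec v + lambda *: x1), m)
  | k'.+1 =>
      let '(xp, x, m) := lion_state G s x1 beta1 beta2 eta lambda B0 k' in
      let t := k'.+2 in
      let g := fun j => G j x (s t j 0%N) in
      let h := fun j => G j xp (s t j 0%N) in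
      let v := fun j => (1 - beta1) *: m j + beta1 *: g j + (1 - beta1) *: (g j - h j) in
      let m' := fun j => (1 - beta2) *: m j + beta2 *: g j + (1 - beta2) *: (g j - h j) in
      (x, x - eta *: (sign_vec (\sum_(j < n) v j) + lambda *: x), m')
  end.

Definition lion_iterate {R : realType} {d n : nat} {Xi : Type}
  (G : 'I_n -> 'rV[R]_d -> Xi -> 'rV[R]_d) (s : nat -> 'I_n -> nat -> Xi)
  (x1 : 'rV[R]_d) (beta1 beta2 eta lambda : R) (B0 : nat) (t : nat) : 'rV[R]_d :=
  (lion_state G s x1 beta1 beta2 eta lambda B0 t.-1).1.1.

(* Main.v *)
Require Import Defs.
From HB Require Import structures.
From mathcomp Require Import all_boot all_order all_algebra.
From mathcomp Require Import all_classical all_reals all_analysis.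
From mathcomp Require Import measurable_realfun.
From mathcomp Require Import ring lra.

(** The momentum error e_t = m_t/n - grad f(x_t) and the error of the update
    direction delta_t = v_t/n - grad f(x_t) satisfy
      e_{t+1} = (1 - beta2) e_t + N_{t+1},
      delta_{t+1} = (1 - beta1) e_t + N'_{t+1},
    where N and N' are averages over the nodes of noises that are centered given
    the past. Adding the samples one at a time, each of them independent of the
    sigma-algebra generated by the previous ones, Fubini removes the cross terms,
    so the second moment grows by the sum of the n noise variances divided by n^2.
    These variances are O(beta^2 sigma^2 + L^2 eta^2 d), because the weight decay
    condition keeps every coordinate of a step below 3 eta / 2. On the other
    hand, along every realization, smoothness of f and the inequality
    a sg(b) >= |a| - 2 |a - c b| give
      (eta / 2) sum_t |grad f(x_t)|_1
        <= Delta + 2 eta sum_t |delta_t|_1 + O(T (L^2 + 1) eta^2 d),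
    and |delta|_1 <= d al / 2 + |delta|^2 / (2 al) with
    al = d^(-1/2) (n T)^(-1/3) turns the second moment bounds into the
    stated rate. *)

Set Implicit Arguments. Unset Strict Implicit. Unset Printing Implicit Defensive.
Import Order.TTheory GRing.Theory Num.Theory.
Import numFieldNormedType.Exports.
Local Open Scope classical_set_scope.
Local Open Scope ring_scope.

(** * Measurability of random vectors *)

Section vector_measurability.
Context {R : realType} {d : nat} {dY : measure_display} {Y : measurableType dY}.
Implicit Types x : Y -> 'rV[R]_d.

(** Coordinatewise, so that lemmas on real functions apply; the next lemmas recover preimages of
    open and of Borel sets. *)
Definition vec_measurable x := forall i, measurable_fun setT (fun y => x y ord0 i).

(** An open set is the union of the boxes [bx p] with rational centre and radius that it contains.
    There are countably many of them, and the preimage of each is a finite intersection of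
    measurable sets. *)
Lemma vec_measurable_open x (U : set 'rV[R]_d) :
  vec_measurable x -> open (U : set ('rV[R]_d : normedModType R)) ->
  measurable (x @^-1` U).
Proof.
move=> mx oU.
pose bx (p : 'rV[rat]_d * rat) : set 'rV[R]_d :=
  [set v | forall i, `|ratr (p.1 ord0 i) - v ord0 i| < ratr p.2].
have -> : x @^-1` U = \bigcup_(p in [set p | bx p `<=` U]) x @^-1` (bx p).
  apply/seteqP; split => [y Uy|y [p /= bU] /bU//].
  have : nbhs (x y) U by apply: open_nbhs_nbhs.
  move=> /nbhs_ballP[e /= e0 eU].
  (* A radius below [e / 2] suffices: the centre is within [ratr r] of [x y], so every point of the
     box is within [e] of it. *)
  have [r /andP[r0 re]] : exists r : rat, (0 : R) < ratr r < e / 2.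
    have /rat_in_itvoo[r] : 0 < e / 2 by lra.
    by rewrite in_itv/=; exists r.
  have /choice[q hq] : forall i : 'I_d, exists s : rat,
      `|(ratr s : R) - x y ord0 i| < ratr r.
    move=> i; have [s] : exists s : rat, (ratr s : R) \in
        `](x y ord0 i - ratr r), (x y ord0 i + ratr r)[.
      by apply: rat_in_itvoo; move: r0; clear; lra.
    by rewrite in_itv/= => hs; exists s; rewrite ltr_distl.
  exists (\row_i q i, r) => /=; last by move=> i; rewrite mxE.
  move=> v /= hv; apply: eU; split => // i j; rewrite (ord1 i) /ball/= /ball_/=.
  have := hv j; have := hq j; rewrite mxE !ltr_distl; move: re; clear; lra.
rewrite bigcup_mkcond; apply: countable_bigcupT_measurable.
  exact: countableP.
move=> p; case: ifP => _; last exact: measurable0.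
have -> : x @^-1` (bx p) =
    \big[setI/setT]_(i < d) [set y | `|ratr (p.1 ord0 i) - x y ord0 i| < ratr p.2].
  apply/seteqP; split => y /=.
    by move=> h; rewrite -bigcap_seq => i _ /=; exact: h.
  by rewrite -bigcap_seq => h i; apply: h; rewrite /= mem_index_enum.
apply: bigsetI_measurable => i _.
have -> : [set y | `|ratr (p.1 ord0 i) - x y ord0 i| < ratr p.2] =
    (fun y => `|ratr (p.1 ord0 i) - x y ord0 i|) @^-1` `]-oo, ratr p.2[.
  by apply/seteqP; split => y; rewrite /= in_itv.
rewrite -[X in measurable X]setTI; apply: measurableT_comp => //.
by apply: measurable_funB => //; exact: mx.
Qed.

Lemma vec_measurable_borel x (U : set 'rV[R]_d) :
  vec_measurable x -> borel_vec U -> measurable (x @^-1` U).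
Proof.
move=> mx; suff : @borel_vec R d `<=` [set A | measurable (x @^-1` A)] by exact.
apply: smallest_sub => [|A oA]; last exact: vec_measurable_open.
split => [|A|F].
- by rewrite /= preimage_set0.
- by rewrite setTD/= => mA; rewrite preimage_setC; exact: measurableC.
- by move=> mF /=; rewrite preimage_bigcup; apply: bigcupT_measurable.
Qed.

Lemma vec_measurable_comp_continuous x (h : 'rV[R]_d -> R) :
  vec_measurable x -> continuous h -> measurable_fun setT (h \o x).
Proof.
move=> mx ch; apply: (measurability _ (RGenOpens.measurableE R)).
move=> _ [_ [a [b ->]]] <-; rewrite setTI comp_preimage.
apply: vec_measurable_open => //.
by move/continuousP : ch; apply; exact: interval_open.
Qed.

(** The sets with measurable preimage under [y |-> (x y, xi y)] form a sigma-algebra that contains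
    the rectangles generating the one of [jointly_measurable]. *)
Lemma jointly_measurable_comp {dX : measure_display} {Xi : measurableType dX}
    (F : 'rV[R]_d -> Xi -> R) x (xi : Y -> Xi) :
  jointly_measurable F -> vec_measurable x -> measurable_fun setT xi ->
  measurable_fun setT (fun y => F (x y) (xi y)).
Proof.
move=> mF mx mxi _ B mB; rewrite setTI.
have -> : (fun y => F (x y) (xi y)) @^-1` B =
  (fun y => (x y, xi y)) @^-1` ((fun p : 'rV[R]_d * Xi => F p.1 p.2) @^-1` B) by [].
suff H : <<s [set Z : set ('rV[R]_d * Xi) |
      exists A C, @borel_vec R d A /\ measurable C /\ Z = A `*` C] >> `<=`
    [set Z | measurable ((fun y => (x y, xi y)) @^-1` Z)] by exact: H (mF _ mB).
apply: smallest_sub => [|_ [A [C [bA [mC ->]]]]].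
  split => [|A|G].
  - by rewrite /= preimage_set0.
  - by rewrite setTD/= => mA; rewrite preimage_setC; exact: measurableC.
  - by move=> mG /=; rewrite preimage_bigcup; apply: bigcupT_measurable.
suff : measurable ((x @^-1` A) `&` (xi @^-1` C)) by [].
apply: measurableI; first exact: vec_measurable_borel.
by rewrite -[X in measurable X]setTI; exact: mxi.
Qed.

End vector_measurability.

(** * Independence from the past *)

Section freezing.
Context {R : realType} {dO : measure_display} {Omega : measurableType dO}.
Context {dX : measure_display} {Xi : measurableType dX}.
Variables (P : probability Omega R) (D : probability Xi R).
Variables (G : set (set Omega)) (X : Omega -> Xi).
Hypothesis mG : G `<=` measurable.
Hypothesis mX : measurable_fun setT X.
Hypothesis indep : forall A B, <<s G >> A -> measurable B ->
  P (A `&` X @^-1` B) = (P A * D B)%E.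

Let OmegaG := g_sigma_algebraType G.

Lemma sub_sigma_measurable : <<s G >> `<=` @measurable _ Omega.
Proof.
apply: smallest_sub => //; split => [|A|F]; first exact: measurable0.
  by rewrite setTD; exact: measurableC.
exact: bigcupT_measurable.
Qed.

Lemma measurable_sub_sigma {dY} {Y : measurableType dY} (f : Omega -> Y) :
  measurable_fun (setT : set OmegaG) f -> measurable_fun setT f.
Proof. by move=> mf _ B mB; apply: sub_sigma_measurable; exact: mf. Qed.

(** The identity into the coarser space; its law is [P] restricted to [<<s G>>]. *)
Let idG : Omega -> OmegaG := id.

Let midG : measurable_fun setT idG.
Proof. by move=> _ A mA; rewrite setTI; exact: sub_sigma_measurable. Qed.

HB.instance Definition _ := isMeasurableFun.Build _ _ _ _ idG midG.

Let pairX : Omega -> OmegaG * Xi := fun w => (idG w, X w).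

Let mpairX : measurable_fun setT pairX.
Proof. exact: measurable_fun_pair. Qed.

HB.instance Definition _ := isMeasurableFun.Build _ _ _ _ pairX mpairX.

(* The law of w |-> (w, X w) on the product of Omega, equipped with <<s G>>, and
   Xi is the product measure, so Tonelli applies. *)
Lemma ge0_integral_freeze (H : OmegaG * Xi -> \bar R) :
  measurable_fun setT H -> (forall p, 0 <= H p)%E ->
  (\int[P]_w H (w, X w) = \int[P]_w \int[D]_z H (w, z))%E.
Proof.
move=> mH H0.
pose PG := distribution P idG.
have <- : (\int[distribution P pairX]_p H p = \int[P]_w H (w, X w))%E.
  exact: ge0_integral_distribution.
rewrite (eq_measure_integral (PG \x D)%E).
  rewrite fubini_tonelli1// ge0_integral_distribution//.
    exact: measurable_fun_fubini_tonelli_F.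
  by move=> w; exact: integral_ge0.
by move=> A mA _; symmetry; apply: product_measure_unique.
Qed.

End freezing.

(** * Sigma-algebras generated by finitely many samples *)

Section rectangles.
Context {R : realType} {dO : measure_display} {Omega : measurableType dO}.
Context {dX : measure_display} {Xi : measurableType dX} {I : choiceType}.
Variables (P : probability Omega R) (X : I -> Omega -> Xi) (S : set I).
Hypothesis mX : forall k, S k -> measurable_fun setT (X k).
Hypothesis indX : mutually_independent P X S.

(* A pi-system generating the sigma-algebra of the samples indexed by s. *)
Definition rectangles (s : seq I) : set (set Omega) :=
  [set A | exists2 B : I -> set Xi, (forall k, measurable (B k)) &
     A = \bigcap_(k in [set` s]) (X k @^-1` B k)].

Lemma rectangles_measurable (s : seq I) : {in s, forall k, S k} ->
  rectangles s `<=` measurable.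
Proof.
move=> sS _ [B mB ->]; rewrite bigcap_seq big_seq.
apply: bigsetI_measurable => k ks; rewrite -[X in measurable X]setTI.
exact: mX (sS _ ks) measurableT _ (mB k).
Qed.

Lemma measurable_rectangles (s : seq I) k : k \in s ->
  measurable_fun (setT : set (g_sigma_algebraType (rectangles s))) (X k).
Proof.
move=> ks _ B mB; rewrite setTI; apply: sub_sigma_algebra.
exists (fun j => if j == k then B else setT) => [j|].
  by case: ifP => // _; exact: measurableT.
apply/seteqP; split => [w Bw j _ /=|w /(_ k ks)/=]; last by rewrite eqxx.
by case: eqP => // ->.
Qed.

(** A rectangle over [s] is also one over [s'], with the full space put at the indices outside
    [s]. *)
Lemma sub_rectangles (s s' : seq I) : {subset s <= s'} ->
  <<s rectangles s >> `<=` <<s rectangles s' >>.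
Proof.
move=> ss'; apply: smallest_sub; first exact: smallest_sigma_algebra.
move=> _ [B mB ->]; apply: sub_sigma_algebra.
exists (fun j => if j \in s then B j else setT) => [j|].
  by case: ifP => // _; exact: measurableT.
apply/seteqP; split => w Bw j /= js.
  by case: ifP => // js'; exact: Bw.
by have := Bw _ (ss' _ js); rewrite /= js.
Qed.

Lemma measurable_fun_rectangles {dY} {Y : measurableType dY} (s s' : seq I)
    (f : Omega -> Y) : {subset s <= s'} ->
  measurable_fun (setT : set (g_sigma_algebraType (rectangles s))) f ->
  measurable_fun (setT : set (g_sigma_algebraType (rectangles s'))) f.
Proof. by move=> ss' mf _ B mB; apply: (sub_rectangles ss'); exact: mf. Qed.

(** For fixed [B], both sides are finite measures in [A]. Mutual independence makes them agree on
    the pi-system of rectangles, hence on the sigma-algebra that it generates. *)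
Lemma independent_rectangles (s : seq I) k0 A B :
  uniq (k0 :: s) -> {in k0 :: s, forall k, S k} ->
  <<s rectangles s >> A -> measurable B ->
  P (A `&` X k0 @^-1` B) = (P A * P (X k0 @^-1` B))%E.
Proof.
move=> us sS sA mB.
have sS' : {in s, forall k, S k} by move=> k ks; apply: sS; rewrite inE ks orbT.
have mXB : measurable (X k0 @^-1` B).
  rewrite -[X in measurable X]setTI; apply: mX => //.
  by apply: sS; rewrite mem_head.
have r0 : 0 <= fine (P (X k0 @^-1` B)) by exact: fine_ge0.
have PE : P (X k0 @^-1` B) = (fine (P (X k0 @^-1` B)))%:E.
  by rewrite fineK// fin_num_measure.
have -> : (P A * P (X k0 @^-1` B))%E = mscale (NngNum r0) P A.
  by rewrite /mscale/= muleC -PE.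
have <- : mrestr P mXB A = P (A `&` X k0 @^-1` B) by [].
have cT : rectangles s setT.
  by exists (fun=> setT) => //; apply/seteqP; split.
apply: (g_sigma_algebra_measure_unique (rectangles s) _ (fun=> setT)) => //.
- exact: rectangles_measurable.
- by apply/seteqP; split => // w _; exists 0%N.
- move=> _ _ [B1 mB1 ->] [B2 mB2 ->].
  exists (fun k => B1 k `&` B2 k) => [k|]; first exact: measurableI.
  by rewrite -bigcapI.
- move=> _ [B1 mB1 ->].
  (* One family for all of [k0 :: s]: since [k0] is not in [s], placing [B] at [k0] leaves the sets
     over [s] unchanged. *)
  pose B2 k := if k == k0 then B else B1 k.
  have mB2 k : measurable (B2 k) by rewrite /B2; case: ifP.
  have nk k : k \in s -> B2 k = B1 k.
    move=> ks; rewrite /B2; case: eqP => // kk0.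
    by move: us; rewrite -kk0 /= ks.
  have := indX us sS mB2.
  rewrite !big_cons {1 3}/B2 eqxx.
  rewrite [in X in X -> _](eq_big_seq (fun k => X k @^-1` B1 k)); last first.
    by move=> k ks /=; rewrite nk.
  rewrite [in X in X -> _](eq_big_seq (fun k => P (X k @^-1` B1 k))); last first.
    by move=> k ks /=; rewrite nk.
  have [_ us'] := andP us.
  rewrite -(indX us' sS' mB1) => E.
  rewrite bigcap_seq.
  suff : P (\big[setI/setT]_(t <- s) (X t @^-1` B1 t) `&` X k0 @^-1` B) =
      ((fine (P (X k0 @^-1` B)))%:E *
       P (\big[setI/setT]_(t <- s) (X t @^-1` B1 t)))%E by [].
  by rewrite setIC E -PE.
- move=> k; suff : (P (setT `&` X k0 @^-1` B) < +oo)%E by [].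
  by rewrite setTI ltey_eq fin_num_measure.
Qed.

End rectangles.

(** * Second moments of the gradient noise *)

Section second_moments.
Context {R : realType} {dX : measure_display} {Xi : measurableType dX}.
Variable D : probability Xi R.
Implicit Types (X : Xi -> R) (c m : R).

Let sqr_integrable X := D.-integrable setT (fun z => (X z ^+ 2)%:E).

Lemma measurable_int_real X : D.-integrable setT (EFin \o X) ->
  measurable_fun setT X.
Proof. by move=> /measurable_int/measurable_EFinP. Qed.

Lemma integral_sqr_lty X : measurable_fun setT X ->
  (\int[D]_z (X z ^+ 2)%:E < +oo)%E -> sqr_integrable X.
Proof.
move=> mX fin; apply/integrableP; split.
  by apply/measurable_EFinP; exact: measurable_funX.
by under eq_integral do rewrite gee0_abs ?lee_fin ?sqr_ge0//.
Qed.

(** Expansion of the square. The three comparisons that follow rest on it and do without square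
    integrability, because an infinite second moment makes each of them trivial. *)
Lemma integral_sqrD X c m : D.-integrable setT (EFin \o X) ->
  sqr_integrable X -> (\int[D]_z (X z)%:E = m%:E)%E ->
  (\int[D]_z ((X z + c) ^+ 2)%:E =
   \int[D]_z (X z ^+ 2)%:E + (2 * c * m + c ^+ 2)%:E)%E.
Proof.
move=> iX iX2 Xm.
have i2 : D.-integrable setT (fun z => (2 * c)%:E * (X z)%:E)%E by exact: integrableZl.
have ic : D.-integrable setT (cst (c ^+ 2)%:E).
  exact: finite_measure_integrable_cst.
rewrite (eq_integral (fun z =>
    (X z ^+ 2)%:E + ((2 * c)%:E * (X z)%:E + (c ^+ 2)%:E)))%E; last first.
  by move=> z _; rewrite -EFinM -!EFinD; congr EFin; ring.
rewrite integralD//; last exact: integrableD.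
rewrite integralD// integralZl// Xm integral_cst//.
rewrite -EFinM EFinD; congr (_ + (_ + _))%E; rewrite -[RHS]mule1.
by congr (_ * _)%E; exact: probability_setT.
Qed.

Lemma integral_sqr_shift_le X c : D.-integrable setT (EFin \o X) ->
  (\int[D]_z (X z)%:E = 0)%E ->
  (\int[D]_z ((c + X z) ^+ 2)%:E <= (c ^+ 2)%:E + \int[D]_z (X z ^+ 2)%:E)%E.
Proof.
move=> iX X0; have mX := measurable_int_real iX.
have [fin|] := ltP (\int[D]_z (X z ^+ 2)%:E)%E +oo%E; last first.
  by rewrite leye_eq => /eqP ->; rewrite addey// leey.
under eq_integral do rewrite addrC.
by rewrite (integral_sqrD _ iX (integral_sqr_lty mX fin) X0) mulr0 add0r addeC.
Qed.

Lemma integral_centered_sqr_le X m : D.-integrable setT (EFin \o X) ->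
  (\int[D]_z (X z)%:E = m%:E)%E ->
  (\int[D]_z ((X z - m) ^+ 2)%:E <= \int[D]_z (X z ^+ 2)%:E)%E.
Proof.
move=> iX Xm; have mX := measurable_int_real iX.
have [fin|] := ltP (\int[D]_z (X z ^+ 2)%:E)%E +oo%E; last first.
  by rewrite leye_eq => /eqP ->; rewrite leey.
rewrite (integral_sqrD _ iX (integral_sqr_lty mX fin) Xm).
rewrite -[leRHS]adde0 leeD2l// lee_fin; nra.
Qed.

(** Jensen for the square: the integral of [(X - m)^2] is nonnegative. *)
Lemma sqr_integral_le X m : D.-integrable setT (EFin \o X) ->
  (\int[D]_z (X z)%:E = m%:E)%E ->
  ((m ^+ 2)%:E <= \int[D]_z (X z ^+ 2)%:E)%E.
Proof.
move=> iX Xm; have mX := measurable_int_real iX.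
have [fin|] := ltP (\int[D]_z (X z ^+ 2)%:E)%E +oo%E; last first.
  by rewrite leye_eq => /eqP ->; rewrite leey.
have : (0 <= \int[D]_z ((X z - m) ^+ 2)%:E)%E.
  by apply: integral_ge0 => z _; rewrite lee_fin sqr_ge0.
rewrite (integral_sqrD _ iX (integral_sqr_lty mX fin) Xm).
have : (\int[D]_z (X z ^+ 2)%:E)%E \is a fin_num.
  by rewrite ge0_fin_numE//; apply: integral_ge0 => z _; rewrite lee_fin sqr_ge0.
move=> /fineK <-; rewrite -EFinD !lee_fin; nra.
Qed.

End second_moments.

Section vectors.
Context {R : realType} {d : nat}.
Implicit Types u v : 'rV[R]_d.

Definition sqnorm v := \sum_(i < d) v ord0 i ^+ 2.

Lemma sqnorm_ge0 v : 0 <= sqnorm v.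
Proof. by apply: sumr_ge0 => i _; exact: sqr_ge0. Qed.

Lemma sqr_norm2 v : norm2 v ^+ 2 = sqnorm v.
Proof. by rewrite sqr_sqrtr// sqnorm_ge0. Qed.

Lemma sqnormZ c v : sqnorm (c *: v) = c ^+ 2 * sqnorm v.
Proof. by rewrite /sqnorm mulr_sumr; apply: eq_bigr => i _; rewrite mxE exprMn. Qed.

End vectors.

Section vector_measurability_ops.
Context {R : realType} {d : nat} {dY : measure_display} {Y : measurableType dY}.
Implicit Types x y : Y -> 'rV[R]_d.

Lemma vec_measurable_cst (v : 'rV[R]_d) : vec_measurable (cst v : Y -> _).
Proof. by move=> i; exact: measurable_cst. Qed.

Lemma vec_measurableD x y : vec_measurable x -> vec_measurable y ->
  vec_measurable (fun w => x w + y w).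
Proof.
move=> mx my i; rewrite (_ : (fun _ => _) = (fun w => x w ord0 i) \+ (fun w => y w ord0 i)).
  exact: measurable_funD.
by apply/funext => w; rewrite mxE.
Qed.

Lemma vec_measurableZ c x : vec_measurable x ->
  vec_measurable (fun w => c *: x w).
Proof.
move=> mx i; rewrite (_ : (fun _ => _) = (fun w => c * x w ord0 i)).
  exact: measurable_funM.
by apply/funext => w; rewrite mxE.
Qed.

Lemma vec_measurableB x y : vec_measurable x -> vec_measurable y ->
  vec_measurable (fun w => x w - y w).
Proof.
move=> mx my; rewrite (_ : (fun _ => _) = (fun w => x w + (-1) *: y w)).
  by apply: vec_measurableD => //; exact: vec_measurableZ.
by apply/funext => w; rewrite scaleN1r.
Qed.

Lemma vec_measurable_sum (I : Type) (r : seq I) (x : I -> Y -> 'rV[R]_d) :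
  (forall k, vec_measurable (x k)) ->
  vec_measurable (fun w => \sum_(k <- r) x k w).
Proof.
move=> mx i; rewrite (_ : (fun _ => _) = (fun w => \sum_(k <- r) x k w ord0 i)).
  by apply: measurable_sum => k; exact: mx.
by apply/funext => w; rewrite summxE.
Qed.

Lemma measurable_sqnorm x : vec_measurable x ->
  measurable_fun setT (fun w => sqnorm (x w)).
Proof. by move=> mx; apply: measurable_sum => i; exact: measurable_funX. Qed.

End vector_measurability_ops.

(** * Mean and variance of the variance-reduced noise of one sample *)

Section vr_noise.
Context {R : realType} {d : nat} {dX : measure_display} {Xi : measurableType dX}.
Variables (L sigma : R) (D : probability Xi R).
Variables (G : 'rV[R]_d -> Xi -> 'rV[R]_d) (g : 'rV[R]_d -> 'rV[R]_d).

(* With g x the mean of G x, this is the centered part of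
   b g_t + (1 - b) (g_t - h_t), where g_t = G x z and h_t = G xp z. *)
Definition vr_noise (b : R) (x xp : 'rV[R]_d) (z : Xi) : 'rV[R]_d :=
  b *: (G x z - g x) + (1 - b) *: ((G x z - G xp z) - (g x - g xp)).

Hypothesis jmG : forall i, jointly_measurable (fun x z => G x z ord0 i).
Hypothesis cg : forall i, continuous (fun x => g x ord0 i).

Lemma vec_measurable_oracle {dY : measure_display} {Y : measurableType dY}
    (x : Y -> 'rV[R]_d) (xi : Y -> Xi) : vec_measurable x ->
  measurable_fun setT xi -> vec_measurable (fun y => G (x y) (xi y)).
Proof. by move=> mx mxi i; exact: (jointly_measurable_comp (jmG i)). Qed.

Lemma vec_measurable_gradient {dY : measure_display} {Y : measurableType dY}
    (x : Y -> 'rV[R]_d) : vec_measurable x -> vec_measurable (g \o x).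
Proof. by move=> mx i; exact: vec_measurable_comp_continuous mx (@cg i). Qed.

Lemma vec_measurable_vr_noise b {dY : measure_display} {Y : measurableType dY}
    (x xp : Y -> 'rV[R]_d) (xi : Y -> Xi) : vec_measurable x ->
  vec_measurable xp -> measurable_fun setT xi ->
  vec_measurable (fun y => vr_noise b (x y) (xp y) (xi y)).
Proof.
move=> mx mxp mxi; have mGx := vec_measurable_oracle mx mxi.
have mGxp := vec_measurable_oracle mxp mxi.
have mg := vec_measurable_gradient mx; have mgp := vec_measurable_gradient mxp.
apply: vec_measurableD; apply: vec_measurableZ; apply: vec_measurableB => //.
  exact: vec_measurableB.
exact: vec_measurableB mg mgp.
Qed.

Hypothesis meanG : forall x i,
  D.-integrable setT (fun z => (G x z ord0 i)%:E) /\
  (\int[D]_z (G x z ord0 i)%:E = (g x ord0 i)%:E)%E.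
Hypothesis lipG : forall x y,
  (\int[D]_z (norm2 (G x z - G y z) ^+ 2)%:E <= (L ^+ 2 * norm2 (x - y) ^+ 2)%:E)%E.
Hypothesis varG : forall x,
  (\int[D]_z (norm2 (G x z - g x) ^+ 2)%:E <= (sigma ^+ 2)%:E)%E.

Lemma integral_oracleB x y i :
  D.-integrable setT (EFin \o (fun z => G x z ord0 i - G y z ord0 i)) /\
  (\int[D]_z (G x z ord0 i - G y z ord0 i)%:E = (g x ord0 i - g y ord0 i)%:E)%E.
Proof.
have [ix ex] := meanG x i; have [iy ey] := meanG y i; split.
  by rewrite (_ : EFin \o _ = (fun z => (G x z ord0 i)%:E) \- (fun z => (G y z ord0 i)%:E))%E;
    first exact: integrableB.
by under eq_integral do rewrite EFinB; rewrite integralB_EFin// ex ey.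
Qed.

Lemma integral_sqnorm (F : Xi -> 'rV[R]_d) :
  (forall i, measurable_fun setT (fun z => F z ord0 i)) ->
  (\int[D]_z (sqnorm (F z))%:E = \sum_(i < d) \int[D]_z (F z ord0 i ^+ 2)%:E)%E.
Proof.
move=> mF; rewrite -ge0_integral_sum//.
- by apply: eq_integral => z _; rewrite sumEFin.
- by move=> i; apply/measurable_EFinP; exact: measurable_funX.
- by move=> i z _; rewrite lee_fin sqr_ge0.
Qed.

Lemma measurable_oracle x i : measurable_fun setT (fun z => G x z ord0 i).
Proof. exact: measurable_int_real (meanG x i).1. Qed.

(** Jensen in each coordinate turns the mean-square smoothness (D2) of the oracle into Lipschitz
    continuity of its mean. *)
Lemma gradient_lipschitz x y : sqnorm (g x - g y) <= L ^+ 2 * sqnorm (x - y).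
Proof.
rewrite -lee_fin -[in leRHS]sqr_norm2; apply: le_trans (lipG x y).
under eq_integral do rewrite sqr_norm2.
rewrite integral_sqnorm; last first.
  move=> i; under eq_fun do rewrite !mxE.
  by apply: measurable_funB; exact: measurable_oracle.
rewrite /sqnorm -sumEFin; apply: lee_sum => i _; rewrite !mxE.
under eq_integral do rewrite !mxE.
by have [iXY eXY] := integral_oracleB x y i; exact: sqr_integral_le.
Qed.

Lemma vr_noise_mean b x xp i :
  D.-integrable setT (EFin \o (fun z => vr_noise b x xp z ord0 i)) /\
  (\int[D]_z (vr_noise b x xp z ord0 i)%:E = 0)%E.
Proof.
have [ix ex] := meanG x i; have [ixy exy] := integral_oracleB x xp i.
(* Minus the deterministic part of the noise; it cancels the mean of the random part. *)
pose c := - (b * g x ord0 i + (1 - b) * (g x ord0 i - g xp ord0 i)).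
have ic : D.-integrable setT (cst c%:E) by exact: finite_measure_integrable_cst.
have i1 : D.-integrable setT (fun z => b%:E * (G x z ord0 i)%:E)%E by exact: integrableZl.
have i2 : D.-integrable setT (fun z => (1 - b)%:E * (G x z ord0 i - G xp z ord0 i)%:E)%E.
  exact: integrableZl.
have E z : (vr_noise b x xp z ord0 i)%:E = (b%:E * (G x z ord0 i)%:E +
    ((1 - b)%:E * (G x z ord0 i - G xp z ord0 i)%:E + c%:E))%E.
  by rewrite -!EFinM -!EFinD /c !mxE; congr EFin; ring.
split.
  rewrite (_ : EFin \o _ = (fun z => b%:E * (G x z ord0 i)%:E) \+
    ((fun z => (1 - b)%:E * (G x z ord0 i - G xp z ord0 i)%:E) \+ cst c%:E))%E.
    by apply: integrableD => //; exact: integrableD.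
  by apply/funext => z /=; rewrite E.
under eq_integral do rewrite E.
rewrite integralD//; last exact: integrableD.
rewrite integralD// !integralZl// ex exy integral_cst//.
transitivity ((b * g x ord0 i)%:E + (((1 - b) * (g x ord0 i - g xp ord0 i))%:E + c%:E * 1))%E.
  by congr (_ + (_ + _ * _))%E; exact: probability_setT.
by rewrite mule1 -!EFinD /c; congr EFin; ring.
Qed.

(** Uses [|u + v|^2 <= 2 |u|^2 + 2 |v|^2]. The first part is the variance in (D3). In the second,
    centering does not increase the second moment, so (D2) applies and the bound shrinks with the
    step [x - xp]. *)
Lemma vr_noise_sqnorm b x xp :
  (\int[D]_z (sqnorm (vr_noise b x xp z))%:E <=
   (2 * b ^+ 2 * sigma ^+ 2 + 2 * (1 - b) ^+ 2 * (L ^+ 2 * sqnorm (x - xp)))%:E)%E.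
Proof.
pose U z := G x z - g x; pose V z := (G x z - G xp z) - (g x - g xp).
have mU i : measurable_fun setT (fun z => U z ord0 i).
  under eq_fun do rewrite !mxE.
  by apply: measurable_funB => //; exact: measurable_oracle.
have mV i : measurable_fun setT (fun z => V z ord0 i).
  under eq_fun do rewrite !mxE.
  by do 2 apply: measurable_funB => //; exact: measurable_oracle.
have mU2 : measurable_fun setT (fun z => (sqnorm (U z))%:E).
  by apply/measurable_EFinP; exact: measurable_sqnorm.
have mV2 : measurable_fun setT (fun z => (sqnorm (V z))%:E).
  by apply/measurable_EFinP; exact: measurable_sqnorm.
have p0 (c : R) : 0 <= 2 * c ^+ 2 by rewrite mulr_ge0// sqr_ge0.
apply: (@le_trans _ _ (\int[D]_z ((2 * b ^+ 2)%:E * (sqnorm (U z))%:E +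
    (2 * (1 - b) ^+ 2)%:E * (sqnorm (V z))%:E))%E).
  apply: ge0_le_integral => //.
  - by move=> z _; rewrite lee_fin sqnorm_ge0.
  - apply/measurable_EFinP; apply: measurable_sqnorm.
    by apply: vec_measurableD; exact: vec_measurableZ.
  - by apply: emeasurable_funD; exact: measurable_funeM.
  - move=> z _; rewrite -!EFinM -EFinD lee_fin /sqnorm !mulr_sumr -big_split/=.
    apply: ler_sum => i _.
    have -> : vr_noise b x xp z ord0 i = b * U z ord0 i + (1 - b) * V z ord0 i.
      by rewrite !mxE.
    have := sqr_ge0 (b * U z ord0 i - (1 - b) * V z ord0 i); lra.
rewrite ge0_integralD//; last first.
- exact: measurable_funeM.
- by move=> z _; rewrite -EFinM lee_fin mulr_ge0// sqnorm_ge0.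
- exact: measurable_funeM.
- by move=> z _; rewrite -EFinM lee_fin mulr_ge0// sqnorm_ge0.
rewrite !ge0_integralZl_EFin//; last first.
- by move=> z _; rewrite lee_fin sqnorm_ge0.
- by move=> z _; rewrite lee_fin sqnorm_ge0.
rewrite EFinD; apply: leeD; rewrite [leRHS]EFinM; apply: lee_wpmul2l; rewrite ?lee_fin//.
  by apply: le_trans (varG x); under [leRHS]eq_integral do rewrite sqr_norm2.
rewrite -sqr_norm2; apply: le_trans (lipG x xp).
under [leRHS]eq_integral do rewrite sqr_norm2.
rewrite !integral_sqnorm//; last first.
  move=> i; under eq_fun do rewrite !mxE.
  by apply: measurable_funB; exact: measurable_oracle.
apply: lee_sum => i _.
under eq_integral do rewrite !mxE.
under [leRHS]eq_integral do rewrite !mxE.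
by have [iXY eXY] := integral_oracleB x xp i; exact: integral_centered_sqr_le.
Qed.

End vr_noise.

(** * Adding the independent noises of a batch *)

Section noise_accumulation.
Context {R : realType} {d : nat} {dO : measure_display} {Omega : measurableType dO}.
Context {dX : measure_display} {Xi : measurableType dX} {I : choiceType}.
Variables (P : probability Omega R) (X : I -> Omega -> Xi) (S : set I).
Variables (D : I -> probability Xi R).
Hypothesis mX : forall k, S k -> measurable_fun setT (X k).
Hypothesis lawX : forall k, S k -> forall A, measurable A -> P (X k @^-1` A) = D k A.
Hypothesis indX : mutually_independent P X S.

Definition past_measurable (s : seq I) (x : Omega -> 'rV[R]_d) :=
  @vec_measurable R d _ (g_sigma_algebraType (rectangles X s)) x.

Lemma past_measurable_sub (s s' : seq I) x : {subset s <= s'} ->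
  past_measurable s x -> past_measurable s' x.
Proof. by move=> ss' mx i; exact: measurable_fun_rectangles ss' (mx i). Qed.

Lemma past_measurable_vec (s : seq I) x : {in s, forall k, S k} ->
  past_measurable s x -> vec_measurable x.
Proof.
move=> sS mx i; have mr := rectangles_measurable mX sS.
exact: (@measurable_sub_sigma _ _ _ mr _ _ (fun w => x w ord0 i) (mx i)).
Qed.

(* For fixed w the cross term 2 c <Sv w, phi w z> integrates to zero in z. *)
Lemma integral_noise_le (s : seq I) k0 (Sv : Omega -> 'rV[R]_d)
    (phi : Omega -> Xi -> 'rV[R]_d) (c K : R) :
  uniq (k0 :: s) -> {in k0 :: s, forall k, S k} -> past_measurable s Sv ->
  @vec_measurable R d _ (g_sigma_algebraType (rectangles X s) * Xi)%type
    (fun p => phi p.1 p.2) ->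
  (forall w i, (D k0).-integrable setT (EFin \o (fun z => phi w z ord0 i)) /\
    (\int[D k0]_z (phi w z ord0 i)%:E = 0)%E) ->
  (forall w, (\int[D k0]_z (sqnorm (phi w z))%:E <= K%:E)%E) ->
  (\int[P]_w (sqnorm (Sv w + c *: phi w (X k0 w)))%:E <=
   \int[P]_w (sqnorm (Sv w))%:E + (c ^+ 2 * K)%:E)%E.
Proof.
move=> us sS mSv mphi phi0 phiK.
have sS' : {in s, forall k, S k} by move=> k ks; apply: sS; rewrite inE ks orbT.
have mrect := rectangles_measurable mX sS'.
have Sk0 : S k0 by apply: sS; rewrite mem_head.
pose H (p : g_sigma_algebraType (rectangles X s) * Xi) : \bar R :=
  (sqnorm (Sv p.1 + c *: phi p.1 p.2))%:E.
have mH : measurable_fun setT H.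
  apply/measurable_EFinP; apply: measurable_sqnorm; apply: vec_measurableD.
    by move=> i; apply: (measurableT_comp (mSv i)); exact: measurable_fst.
  exact: vec_measurableZ.
have H0 p : (0 <= H p)%E by rewrite lee_fin sqnorm_ge0.
have indep A B : <<s rectangles X s >> A -> measurable B ->
    P (A `&` X k0 @^-1` B) = (P A * D k0 B)%E.
  by move=> sA mB; rewrite (independent_rectangles mX indX us sS)// lawX.
rewrite (ge0_integral_freeze mrect (mX Sk0) indep mH H0).
have mSv' := past_measurable_vec sS' mSv.
have mS2 : measurable_fun setT (fun w => (sqnorm (Sv w))%:E).
  by apply/measurable_EFinP; exact: measurable_sqnorm.
have c0 : (0 <= c ^+ 2 * K)%R.
  rewrite mulr_ge0 ?sqr_ge0// -lee_fin; apply: le_trans (phiK point).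
  by apply: integral_ge0 => z _; rewrite lee_fin sqnorm_ge0.
have -> : (\int[P]_w (sqnorm (Sv w))%:E + (c ^+ 2 * K)%:E =
    \int[P]_w ((sqnorm (Sv w))%:E + (c ^+ 2 * K)%:E))%E.
  rewrite ge0_integralD//; last by move=> w _; rewrite lee_fin sqnorm_ge0.
  congr (_ + _)%E; rewrite integral_cst// -[LHS]mule1.
  by congr (_ * _)%E; symmetry; exact: probability_setT.
have mphiw w i : measurable_fun setT (fun z => phi w z ord0 i).
  exact: measurable_int_real (phi0 w i).1.
apply: ge0_le_integral => //.
- by move=> w _; exact: integral_ge0.
- apply: (@measurable_sub_sigma _ _ _ mrect _ _
    (fun w => (\int[D k0]_z H (w, z))%E)).
  exact: measurable_fun_fubini_tonelli_F.
- by apply: emeasurable_funD => //; exact: measurable_cst.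
move=> w _; rewrite /H /= integral_sqnorm; last first.
  apply: vec_measurableD; first exact: vec_measurable_cst.
  by apply: vec_measurableZ; exact: mphiw.
apply: (@le_trans _ _ (\sum_(i < d) ((Sv w ord0 i ^+ 2)%:E +
    (c ^+ 2)%:E * \int[D k0]_z (phi w z ord0 i ^+ 2)%:E))%E).
  apply: lee_sum => i _; have [iphi ephi] := phi0 w i.
  have := @integral_sqr_shift_le _ _ _ (D k0) (fun z => c * phi w z ord0 i) (Sv w ord0 i).
  rewrite (_ : EFin \o _ = (fun z => c%:E * (phi w z ord0 i)%:E)%E)//.
  under [X in X = _ -> _]eq_integral do rewrite EFinM.
  rewrite integralZl// ephi mule0.
  move=> /(_ (integrableZl _ _ iphi) erefl) h.
  under eq_integral do rewrite !mxE.
  apply: le_trans; first exact: h.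
  apply: leeD2l => //.
  under eq_integral do rewrite exprMn EFinM.
  rewrite ge0_integralZl_EFin//; first by move=> z _; rewrite lee_fin sqr_ge0.
    by apply/measurable_EFinP; exact: measurable_funX.
  exact: sqr_ge0.
rewrite big_split/= sumEFin leeD2l// -ge0_sume_distrr; last first.
  by move=> i _; apply: integral_ge0 => z _; rewrite lee_fin sqr_ge0.
by rewrite [leRHS]EFinM lee_wpmul2l// ?lee_fin ?sqr_ge0// -integral_sqnorm.
Qed.

Variables (L sigma : R) (G : I -> 'rV[R]_d -> Xi -> 'rV[R]_d).
Variable g : I -> 'rV[R]_d -> 'rV[R]_d.
Hypothesis jmG : forall k i, jointly_measurable (fun x z => G k x z ord0 i).
Hypothesis cg : forall k i, continuous (fun x => g k x ord0 i).
Hypothesis meanG : forall k x i,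
  (D k).-integrable setT (fun z => (G k x z ord0 i)%:E) /\
  (\int[D k]_z (G k x z ord0 i)%:E = (g k x ord0 i)%:E)%E.
Hypothesis lipG : forall k x y,
  (\int[D k]_z (norm2 (G k x z - G k y z) ^+ 2)%:E <= (L ^+ 2 * norm2 (x - y) ^+ 2)%:E)%E.
Hypothesis varG : forall k x,
  (\int[D k]_z (norm2 (G k x z - g k x) ^+ 2)%:E <= (sigma ^+ 2)%:E)%E.

Lemma past_measurable_noise_sum (s l : seq I) (x xp : Omega -> 'rV[R]_d) (b : R) :
  past_measurable s x -> past_measurable s xp ->
  past_measurable (l ++ s)
    (fun w => \sum_(k <- l) vr_noise (G k) (g k) b (x w) (xp w) (X k w)).
Proof.
move=> mx mxp; rewrite /past_measurable.
(* [vec_measurable_sum] asks for measurability at every index, while a sample outside [l ++ s] need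
   not be measurable here; terms outside [l] are therefore replaced by 0. *)
have -> : (fun w => \sum_(k <- l) vr_noise (G k) (g k) b (x w) (xp w) (X k w)) =
    (fun w => \sum_(k <- l)
      if k \in l then vr_noise (G k) (g k) b (x w) (xp w) (X k w) else 0).
  by apply/funext => w; rewrite [LHS]big_seq big_mkcond.
apply: vec_measurable_sum => k; case kl: (k \in l); last exact: vec_measurable_cst.
apply: vec_measurable_vr_noise => //.
- by apply: past_measurable_sub mx => j js; rewrite mem_cat js orbT.
- by apply: past_measurable_sub mxp => j js; rewrite mem_cat js orbT.
- by apply: measurable_rectangles; rewrite mem_cat kl.
Qed.

(** Induction adds the samples of [l] one at a time. When [k] enters, [l ++ s] acts as the past,
    while [x] and [xp] depend on [s] alone; so [k] is independent of everything already present and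
    its noise adds only its variance. *)
Lemma integral_noise_sum_le (s l : seq I) (Sv x xp : Omega -> 'rV[R]_d) (b c V : R) :
  uniq (l ++ s) -> {in l ++ s, forall k, S k} ->
  past_measurable s Sv -> past_measurable s x -> past_measurable s xp ->
  (forall w, (1 - b) ^+ 2 * sqnorm (x w - xp w) <= V) ->
  (\int[P]_w (sqnorm (Sv w + c *:
      \sum_(k <- l) vr_noise (G k) (g k) b (x w) (xp w) (X k w)))%:E <=
   \int[P]_w (sqnorm (Sv w))%:E +
     ((size l)%:R * (c ^+ 2 * (2 * b ^+ 2 * sigma ^+ 2 + 2 * L ^+ 2 * V)))%:E)%E.
Proof.
move=> + + mSv mx mxp xV; set K := 2 * b ^+ 2 * _ + _.
elim: l => [|k l IH] us sS.
  by rewrite mul0r adde0; under eq_integral do rewrite big_nil scaler0 addr0.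
have sS' : {in l ++ s, forall k, S k} by move=> j js; apply: sS; rewrite inE js orbT.
have us' : uniq (l ++ s) by case/andP : us.
apply: (@le_trans _ _ (\int[P]_w (sqnorm (Sv w + c *:
      \sum_(k <- l) vr_noise (G k) (g k) b (x w) (xp w) (X k w)))%:E +
    (c ^+ 2 * K)%:E)%E); last first.
  rewrite -natr1 mulrDl mul1r EFinD addeA; apply: leeD2r.
  exact: IH.
under eq_integral do rewrite big_cons scalerDr addrCA addrC.
have sub : {subset s <= l ++ s} by move=> j js; rewrite mem_cat js orbT.
pose phi w z := vr_noise (G k) (g k) b (x w) (xp w) z.
apply: (integral_noise_le (s := l ++ s) (k0 := k) (phi := phi)) => //.
- apply: vec_measurableD; first exact: past_measurable_sub mSv.
  by apply: vec_measurableZ; exact: past_measurable_noise_sum.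
- apply: vec_measurable_vr_noise => //.
  + by move=> i; apply: (measurableT_comp (past_measurable_sub sub mx i)).
  + by move=> i; apply: (measurableT_comp (past_measurable_sub sub mxp i)).
- by move=> w i; exact: vr_noise_mean.
- move=> w; apply: le_trans; first exact: vr_noise_sqnorm.
  rewrite lee_fin /K; have := xV w; have := sqr_ge0 L; nra.
Qed.

End noise_accumulation.

(** * Smoothness and descent *)

Section smoothness.
Context {R : realType} {d : nat}.
Implicit Types (f : 'rV[R]_d -> R) (x y h : 'rV[R]_d).

Lemma derive_grad f x h : differentiable f x ->
  'D_h f x = \sum_(i < d) grad f x ord0 i * h ord0 i.
Proof.
move=> df; rewrite deriveE// [in LHS](row_sum_delta h) linear_sum.
apply: eq_bigr => i _; rewrite linearZ mxE deriveE//= mulrC.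
by congr (_ * 'd f x (delta_mx _ _)); apply: ord_inj.
Qed.

(** The mean value theorem on [0, 1] for [s |-> f (x + s h)], whose difference quotients at [s] are
    those of [f] at [x + s h] along [h]. *)
Lemma descent_mvt f x h : (forall z, differentiable f z) ->
  exists2 c : R, 0 < c < 1 & f (x + h) - f x = 'D_h f (x + c *: h).
Proof.
move=> df; pose p (s : R) := f (x + s *: h).
have dp (s : R) : is_derive s (1 : R) p ('D_h f (x + s *: h)).
  have E : (fun k : R => k^-1 *: ((p \o shift s) (k *: (1 : R)) - p s)) =
      (fun k : R => k^-1 *: ((f \o shift (x + s *: h)) (k *: h) - f (x + s *: h))).
    apply/funext => k /=; rewrite /p [k *: _]mulr1 scalerDl.
    by rewrite addrCA.
  split; last by rewrite /derive E.
  by rewrite /derivable E; exact: diff_derivable.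
have cp : {within `[0, 1], continuous p}.
  apply: derivable_within_continuous => s _.
  by have [] := dp s.
have [c c01 E] := MVT ltr01 (fun s _ => dp s) cp.
exists c; first by move: c01; rewrite in_itv.
by rewrite subr0 mulr1 /p scale1r scale0r addr0 in E.
Qed.

(* The mean value theorem and a b <= (a^2 + b^2) / 2 suffice here, at the cost of
   the constant (L^2 + 1) / 2 instead of L / 2. *)
Lemma descent f x h (L : R) : (forall z, differentiable f z) ->
  (forall y z, sqnorm (grad f y - grad f z) <= L ^+ 2 * sqnorm (y - z)) ->
  f (x + h) <= f x + \sum_(i < d) grad f x ord0 i * h ord0 i
    + (L ^+ 2 + 1) / 2 * sqnorm h.
Proof.
move=> df lipf; have [c /andP[c0 c1] E] := descent_mvt x h df.
rewrite -[f (x + h)](subrK (f x)) E addrC -addrA lerD2l derive_grad//.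
rewrite -lerBlDl -sumrB.
have H1 : \sum_(i < d) (grad f (x + c *: h) ord0 i * h ord0 i - grad f x ord0 i * h ord0 i)
    <= (sqnorm (grad f (x + c *: h) - grad f x) + sqnorm h) / 2.
  rewrite mulrDl /sqnorm !mulr_suml -big_split/=; apply: ler_sum => i _.
  rewrite !mxE.
  have := sqr_ge0 (grad f (x + c *: h) ord0 i - grad f x ord0 i - h ord0 i).
  rewrite !mxE; lra.
apply: le_trans H1 _; rewrite [leRHS]mulrAC ler_pM2r ?invr_gt0//.
have := lipf (x + c *: h) x; rewrite addrAC subrr add0r sqnormZ.
have := sqnorm_ge0 h; move: (sqnorm h) => q q0.
have cc : c ^+ 2 <= 1 by nra.
have : L ^+ 2 * (c ^+ 2 * q) <= L ^+ 2 * q.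
  by rewrite ler_wpM2l ?sqr_ge0// ler_piMl.
lra.
Qed.

(** Cauchy-Schwarz against the constant vector, from [\sum_j (n a_j - A)^2 >= 0] with [A] the sum of
    the [a_j]. *)
Lemma sqr_sum_le n (a : 'I_n -> R) :
  (\sum_(j < n) a j) ^+ 2 <= n%:R * \sum_(j < n) a j ^+ 2.
Proof.
case: n a => [a|n a]; first by rewrite !big_ord0 expr0n mulr0.
set A := \sum_j a j; set B := \sum_j a j ^+ 2.
have n0 : 0 < n.+1%:R :> R by [].
have : 0 <= \sum_(j < n.+1) (n.+1%:R * a j - A) ^+ 2 by apply: sumr_ge0 => j _; exact: sqr_ge0.
have -> : \sum_(j < n.+1) (n.+1%:R * a j - A) ^+ 2 =
    n.+1%:R ^+ 2 * B + (- 2 * n.+1%:R * A) * A + n.+1%:R * A ^+ 2.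
  rewrite (eq_bigr (fun j => n.+1%:R ^+ 2 * a j ^+ 2 + ((- 2 * n.+1%:R * A) * a j + A ^+ 2))).
    by rewrite !big_split/= -!mulr_sumr sumr_const card_ord -/A -/B; ring.
  by move=> j _; ring.
move=> H; rewrite -(ler_pM2l n0); move: H.
move: (n.+1%:R) n0 => m m0; lra.
Qed.

Lemma grad_avg n (fj : 'I_n -> 'rV[R]_d -> R) x :
  (forall j y, differentiable (fj j) y) ->
  grad (fun y => n%:R^-1 * \sum_(j < n) fj j y) x =
  n%:R^-1 *: \sum_(j < n) grad (fj j) x.
Proof.
move=> df; apply/rowP => i; rewrite !mxE summxE.
have -> : (fun y => n%:R^-1 * \sum_(j < n) fj j y) = n%:R^-1 \*: (\sum_(j < n) fj j).
  by apply/funext => y; rewrite /= fct_sumE.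
rewrite deriveZ; last by apply: derivable_sum => j; exact: diff_derivable.
rewrite derive_sum; last by move=> j; exact: diff_derivable.
by congr (_ *: _); apply: eq_bigr => j _; rewrite mxE.
Qed.

Lemma differentiable_avg n (fj : 'I_n -> 'rV[R]_d -> R) x :
  (forall j y, differentiable (fj j) y) ->
  differentiable (fun y => n%:R^-1 * \sum_(j < n) fj j y) x.
Proof.
move=> df.
have -> : (fun y => n%:R^-1 * \sum_(j < n) fj j y) = n%:R^-1 \*: (\sum_(j < n) fj j).
  by apply/funext => y; rewrite /= fct_sumE.
by apply: differentiableZ; apply: differentiable_sum.
Qed.

Lemma sqnorm_avg_le n (u : 'I_n -> 'rV[R]_d) (B : R) : (0 < n)%N ->
  (forall j, sqnorm (u j) <= B) -> sqnorm (n%:R^-1 *: \sum_(j < n) u j) <= B.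
Proof.
move=> n0 uB; have n0' : 0 < n%:R :> R by rewrite ltr0n.
have H : sqnorm (\sum_(j < n) u j) <= n%:R * \sum_(j < n) sqnorm (u j).
  rewrite /sqnorm exchange_big/= mulr_sumr; apply: ler_sum => i _.
  by rewrite summxE; exact: sqr_sum_le.
rewrite sqnormZ exprVn mulrC ler_pdivrMr ?exprn_gt0//.
apply: (le_trans H); rewrite expr2 mulrA [leRHS]mulrC ler_pM2l//.
have -> : B * n%:R = \sum_(j < n) B by rewrite sumr_const card_ord mulr_natr.
exact: ler_sum.
Qed.

(** The topology on row vectors is that of the max-norm, hence a factor [d] when [sqnorm] is bounded
    on a ball. *)
Lemma lipschitz_vec_continuous (g : 'rV[R]_d -> 'rV[R]_d) (L : R) i :
  (forall x y, sqnorm (g x - g y) <= L ^+ 2 * sqnorm (x - y)) ->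
  continuous (fun x => g x ord0 i).
Proof.
move=> lip x A /= /(nbhs_ballP (g x ord0 i)) [e /= e0 eA].
(* The added 1 makes [K] positive and gives [L^2 d (e / K)^2 = (K - 1) e^2 / K^2 < e^2]. *)
pose K := L ^+ 2 * d%:R + 1.
have K1 : 1 <= K by rewrite lerDr mulr_ge0// sqr_ge0.
have eK : 0 < e / K by rewrite divr_gt0//; lra.
apply/nbhs_ballP; exists (e / K) => //= y [_ hy]; apply: eA; rewrite /ball/= /ball_/=.
have Hy j : `|x ord0 j - y ord0 j| < e / K by exact: (hy ord0 j).
have sq : (g x ord0 i - g y ord0 i) ^+ 2 < e ^+ 2.
  have le1 : (g x ord0 i - g y ord0 i) ^+ 2 <= sqnorm (g x - g y).
    rewrite /sqnorm (bigD1 i)//= !mxE lerDl; apply: sumr_ge0 => j _; exact: sqr_ge0.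
  have le2 : sqnorm (x - y) <= d%:R * (e / K) ^+ 2.
    rewrite mulr_natl -[X in _ *+ X]card_ord -sumr_const; apply: ler_sum => j _.
    by rewrite !mxE; move: (Hy j); rewrite ltr_norml => /andP[]; nra.
  apply: (le_lt_trans le1); apply: (le_lt_trans (lip x y)).
  have le3 : L ^+ 2 * sqnorm (x - y) <= L ^+ 2 * (d%:R * (e / K) ^+ 2).
    by rewrite ler_wpM2l// sqr_ge0.
  apply: (le_lt_trans le3); rewrite mulrA exprMn exprVn.
  have -> : L ^+ 2 * d%:R = K - 1 by rewrite /K addrK.
  rewrite mulrCA gtr_pMr ?exprn_gt0// ltr_pdivrMr ?exprn_gt0; nra.
by rewrite ltr_norml; apply/andP; split; nra.
Qed.

End smoothness.

(** * Sign descent with weight decay along one trajectory *)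

Section sign_descent.
Context {R : realType} {d : nat}.
Implicit Types u v x : 'rV[R]_d.

(** If the sign of [b] differs from that of [a], then [|a| <= |a - c * b|], so the loss is at most
    [2 * |a - c * b|]. A positive [c] does not affect the sign; [c = 1 / n] will compare the sum
    over the nodes with an average. *)
Lemma mul_sgr_ge (a b c : R) : 0 < c -> `|a| - 2 * `|a - c * b| <= a * Num.sg b.
Proof.
move=> c0; have [->|b0|b0] := sgrP b; first by rewrite !mulr0 subr0; have := normr_ge0 a; lra.
- rewrite mulr1; have cb : 0 < c * b by exact: mulr_gt0.
  have [a0|a0] := leP 0 a; first by rewrite (ger0_norm a0); have := normr_ge0 (a - c * b); lra.
  by rewrite (ltr0_norm a0) ltr0_norm; lra.
- rewrite mulrN1; have cb : c * b < 0 by rewrite pmulr_rlt0.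
  have [a0|a0] := leP 0 a; last by rewrite (ltr0_norm a0); have := normr_ge0 (a - c * b); lra.
  by rewrite (ger0_norm a0) gtr0_norm; lra.
Qed.

(** [t <= al / 2 + t^2 / (2 al)] in each coordinate; the weight [al] is tuned at the end. *)
Lemma norm1_le_sqnorm v (al : R) : 0 < al ->
  norm1 v <= d%:R * (al / 2) + sqnorm v / (2 * al).
Proof.
move=> al0; rewrite /norm1 /sqnorm.
have -> : d%:R * (al / 2) = \sum_(i < d) (al / 2).
  by rewrite sumr_const card_ord mulr_natl.
rewrite mulr_suml -big_split/=; apply: ler_sum => i _.
rewrite -(ler_pM2l (_ : 0 < 2 * al)) ?mulr_gt0// mulrDr.
have -> : 2 * al * (v ord0 i ^+ 2 / (2 * al)) = `|v ord0 i| ^+ 2.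
  by rewrite real_normK ?num_real// mulrC divfK// mulf_neq0// gt_eqF.
have := sqr_ge0 (`|v ord0 i| - al); lra.
Qed.

Lemma normInf_le x (e : R) i : normInf x <= e -> `|x ord0 i| <= e.
Proof.
apply: le_trans; rewrite /normInf.
exact: (le_bigmax 0 (fun i => `|x ord0 i|) i).
Qed.

Variables (X V : nat -> 'rV[R]_d) (eta lambda : R) (T : nat).
Hypothesis XE : forall k, X k.+1 = X k - eta *: (sign_vec (V k) + lambda *: X k).
Hypothesis eta0 : 0 < eta.
Hypothesis lambda0 : 0 <= lambda.
Hypothesis T0 : (0 < T)%N.
Hypothesis lambdaT : 2 * (eta * lambda) * T%:R <= 1.
Hypothesis X0 : forall i, `|X 0 ord0 i| <= eta.

(** A step scales the coordinate by [1 - eta * lambda], which lies in [0, 1], and then moves it by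
    at most [eta]. *)
Lemma iterate_bound k i : `|X k ord0 i| <= eta * k.+1%:R.
Proof.
elim: k => [|k IH]; first by rewrite mulr1.
rewrite XE !mxE.
have -> : X k ord0 i - eta * (Num.sg (V k ord0 i) + lambda * X k ord0 i) =
  (1 - eta * lambda) * X k ord0 i - eta * Num.sg (V k ord0 i) by ring.
apply: (le_trans (ler_normB _ _)); rewrite -[in leRHS]natr1 mulrDr mulr1.
have el0 : 0 <= eta * lambda by rewrite mulr_ge0// ltW.
have T1 : 1 <= T%:R :> R by rewrite ler1n.
have el1 : eta * lambda <= 1.
  by move: el0 lambdaT T1; move: (eta * lambda) (T%:R : R) => e t; nra.
apply: lerD.
  rewrite normrM; apply: le_trans IH; rewrite ler_piMl// ger0_norm; lra.
rewrite normrM gtr0_norm// ler_piMr ?(ltW eta0)// normr_sg.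
by rewrite lern1 leq_b1.
Qed.

(** Linear growth of the iterates and [k + 1 <= T] keep the decay term below half of a sign step. *)
Lemma weight_decay_bound k i : (k < T)%N -> lambda * `|X k ord0 i| <= 1 / 2.
Proof.
move=> kT; have kT' : k.+1%:R <= T%:R :> R by rewrite ler_nat.
have h := ler_wpM2l lambda0 (iterate_bound k i).
apply: (le_trans h).
have : lambda * eta * k.+1%:R <= lambda * eta * T%:R.
  by rewrite ler_wpM2l// mulr_ge0// ltW.
move: lambdaT; move: (k.+1%:R : R) (T%:R : R) => k1 t; lra.
Qed.

Lemma step_bound k i : (k < T)%N -> `|X k.+1 ord0 i - X k ord0 i| <= 3 / 2 * eta.
Proof.
move=> kT; rewrite XE !mxE.
have -> : X k ord0 i - eta * (Num.sg (V k ord0 i) + lambda * X k ord0 i) - X k ord0 i =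
  - (eta * (Num.sg (V k ord0 i) + lambda * X k ord0 i)) by ring.
rewrite normrN normrM gtr0_norm// mulrC ler_pM2r//.
apply: (le_trans (ler_normD _ _)); rewrite normrM (ger0_norm lambda0).
have := weight_decay_bound i kT.
have : `|Num.sg (V k ord0 i)| <= 1 by rewrite normr_sg lern1 leq_b1.
lra.
Qed.

Lemma sqnorm_step_bound k : (k < T)%N ->
  sqnorm (X k.+1 - X k) <= d%:R * (9 / 4 * eta ^+ 2).
Proof.
move=> kT; rewrite mulr_natl -[X in _ *+ X]card_ord -sumr_const.
apply: ler_sum => i _.
have := step_bound i kT; rewrite [(X k.+1 - X k) ord0 i]mxE [(- X k) ord0 i]mxE.
by rewrite ler_norml => /andP[]; nra.
Qed.

Variables (f : 'rV[R]_d -> R) (L c : R).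
Hypothesis df : forall z, differentiable f z.
Hypothesis lipf : forall y z, sqnorm (grad f y - grad f z) <= L ^+ 2 * sqnorm (y - z).
Hypothesis c0 : 0 < c.

(** The quadratic term of [descent] for a step whose coordinates are at most [3 eta / 2]. *)
Let curv := (L ^+ 2 + 1) / 2 * (d%:R * (9 / 4 * eta ^+ 2)).

Lemma one_step_descent k : (k < T)%N ->
  f (X k.+1) <= f (X k) - eta / 2 * norm1 (grad f (X k))
    + 2 * eta * norm1 (c *: V k - grad f (X k)) + curv.
Proof.
move=> kT; have := descent (X k) (X k.+1 - X k) df lipf.
rewrite addrC subrK => H; apply: (le_trans H).
have q := sqnorm_step_bound kT.
have h1 : (L ^+ 2 + 1) / 2 * sqnorm (X k.+1 - X k) <= curv.
  by rewrite /curv ler_wpM2l// divr_ge0// addr_ge0// sqr_ge0.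
rewrite -addrA -[leRHS]addrA -[leRHS]addrA lerD2l addrA; apply: lerD => //.
rewrite /norm1 !mulr_sumr -sumrN -big_split/=; apply: ler_sum => i _.
(* In each coordinate the sign gains [|g|] up to twice the direction error, and the decay costs at
   most [|g| / 2]; this leaves the factor [eta / 2]. *)
have key (x v g : R) : lambda * `|x| <= 1 / 2 ->
    g * (x - eta * (Num.sg v + lambda * x) - x) <=
    - (eta / 2 * `|g|) + 2 * eta * `|c * v - g|.
  move=> lx; have s := mul_sgr_ge g v c0.
  have h2 : - (g * (lambda * x)) <= `|g| * (1 / 2).
    apply: le_trans (ler_norm _) _; rewrite normrN !normrM (ger0_norm lambda0).
    exact: ler_wpM2l.
  rewrite (distrC (c * v)).
  have h3 : - (g * Num.sg v) - g * (lambda * x) <= - (`|g| / 2) + 2 * `|g - c * v|.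
    by move: s h2; move: (`|g|) (`|_|) (g * Num.sg v) (g * _) => *; lra.
  have := ler_wpM2l (ltW eta0) h3; lra.
by rewrite XE !mxE; exact/key/weight_decay_bound.
Qed.

Lemma descent_sum :
  eta / 2 * \sum_(0 <= k < T) norm1 (grad f (X k)) <=
  f (X 0) - f (X T) + 2 * eta * \sum_(0 <= k < T) norm1 (c *: V k - grad f (X k))
   + T%:R * curv.
Proof.
(* The end of the sums varies while [T] stays fixed, because the step bounds are tied to [T]. *)
have : forall m, (m <= T)%N -> eta / 2 * \sum_(0 <= k < m) norm1 (grad f (X k)) <=
  f (X 0) - f (X m) + 2 * eta * \sum_(0 <= k < m) norm1 (c *: V k - grad f (X k))
   + m%:R * curv; last by apply.
elim=> [|m IH] mT.
  by rewrite !big_geq// !mulr0 mul0r subrr !addr0.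
rewrite !big_nat_recr//= !mulrDr -(natr1 m) mulrDl mul1r.
have := IH (ltnW mT); have := one_step_descent mT.
move: (f _) (f _) (f _) (norm1 _) (norm1 _) (\sum_(_ <= _ < _) _)
  (\sum_(_ <= _ < _) _) (m%:R : R) curv => *; lra.
Qed.

End sign_descent.

(** * Error recursion of Dis-Lion-VR *)

Section lion.
Context {R : realType} {n d : nat} {dO : measure_display} {Omega : measurableType dO}.
Context {dX : measure_display} {Xi : measurableType dX}.
Variables (P : probability Omega R) (D : 'I_n -> probability Xi R).
Variables (fj : 'I_n -> 'rV[R]_d -> R) (G : 'I_n -> 'rV[R]_d -> Xi -> 'rV[R]_d).
Variables (xi : nat -> 'I_n -> nat -> Omega -> Xi).
Variables (x1 : 'rV[R]_d) (beta1 beta2 eta lambda L sigma : R) (B0 : nat).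

Let f := fun x => n%:R^-1 * \sum_(j < n) fj j x.
Let gj j x := grad (fj j) x.
Let sample (p : nat * 'I_n * nat) := xi p.1.1 p.1.2 p.2.
Let state k w := lion_state G (fun t j i => xi t j i w) x1 beta1 beta2 eta lambda B0 k.

(* Time is shifted by one: index k below refers to time t = k + 1. *)
Definition lion_x k w := (state k w).1.1.
Definition lion_m k w j := (state k w).2 j.

(* v_{k+2}^j for b = beta1 and m_{k+2}^j for b = beta2. *)
Definition lion_update b k w j :=
  let g := G j (lion_x k.+1 w) (xi k.+2 j 0%N w) in
  let h := G j (lion_x k w) (xi k.+2 j 0%N w) in
  (1 - b) *: lion_m k w j + b *: g + (1 - b) *: (g - h).

(** The case split reflects [v_1^j = m_1^j] at the initial time. *)
Definition lion_v k w :=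
  if k is k'.+1 then \sum_(j < n) lion_update beta1 k' w j
  else \sum_(j < n) lion_m 0 w j.

Lemma lion_xS k w :
  lion_x k.+1 w = lion_x k w - eta *: (sign_vec (lion_v k w) + lambda *: lion_x k w).
Proof.
rewrite {1}/lion_x /state /=; case: k => [//|k] /=.
rewrite /lion_v /lion_update /lion_x /lion_m /state /=.
by case: (lion_state _ _ _ _ _ _ _ _ k) => [[xp x] m].
Qed.

Lemma lion_mS k w j : lion_m k.+1 w j = lion_update beta2 k w j.
Proof.
rewrite /lion_update /lion_x /lion_m /state /=.
by case: (lion_state _ _ _ _ _ _ _ _ k) => [[xp x] m].
Qed.

Definition batch k : seq (nat * 'I_n * nat) :=
  if k is 0%N then [seq (1%N, j, i) | j <- enum 'I_n, i <- index_iota 0 B0]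
  else [seq (k.+1, j, 0%N) | j <- enum 'I_n].

(** Newest batch first, which is the shape [l ++ s] of [integral_noise_sum_le]. *)
Fixpoint past k := if k is k'.+1 then batch k ++ past k' else batch 0.

Lemma mem_batch k p : p \in batch k -> p.1.1 = k.+1 /\ used_index B0 p.
Proof.
case: k => [|k].
  move=> /allpairsP[[j i] [_ /=]]; rewrite mem_index_iota => /= iB ->.
  by split=> //; left.
by move=> /mapP[j _ ->]; split=> //; right.
Qed.

Lemma mem_past k p : p \in past k -> (p.1.1 <= k.+1)%N /\ used_index B0 p.
Proof.
elim: k => [|k IH]; first by move=> /mem_batch[-> ?].
rewrite mem_cat => /orP[/mem_batch[-> ?]//|/IH[pk ?]].
by split=> //; exact: leqW.
Qed.

Lemma past_used k : {in past k, forall p, used_index B0 p}.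
Proof. by move=> p /mem_past[]. Qed.

Lemma batch_uniq k : uniq (batch k).
Proof.
case: k => [|k].
  by apply: allpairs_uniq; rewrite ?enum_uniq ?iota_uniq// => -[? ?] [? ?] _ _ [-> ->].
by rewrite map_inj_uniq ?enum_uniq// => ? ? [].
Qed.

Lemma past_uniq k : uniq (past k).
Proof.
elim: k => [|k IH]; first exact: batch_uniq.
rewrite -[past k.+1]/(batch k.+1 ++ past k) cat_uniq IH andbT batch_uniq andTb.
apply/hasPn => p /mem_past[pk _]; apply/negP => /mem_batch[E _].
by rewrite E ltnn in pk.
Qed.

Lemma sub_past k : {subset past k <= past k.+1}.
Proof. by move=> p pk; rewrite mem_cat pk orbT. Qed.

Hypothesis n0 : (0 < n)%N.
Hypothesis B0_gt0 : (0 < B0)%N.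
Hypothesis df : forall j x, differentiable (fj j) x.

Let n0' : n%:R != 0 :> R. Proof. by rewrite pnatr_eq0 -lt0n. Qed.

Lemma grad_f x : grad f x = n%:R^-1 *: \sum_(j < n) gj j x.
Proof. exact: grad_avg. Qed.

Definition lion_err k w := n%:R^-1 *: (\sum_(j < n) lion_m k w j) - grad f (lion_x k w).
Definition lion_dir_err k w := n%:R^-1 *: lion_v k w - grad f (lion_x k w).

(** At [k = 0] the predecessor [k.-1] is again 0, so the difference part vanishes and [b = 1] leaves
    the plain sampling noise. *)
Definition batch_noise b k w : 'rV[R]_d := \sum_(p <- batch k)
  vr_noise (G p.1.2) (gj p.1.2) b (lion_x k w) (lion_x k.-1 w) (sample p w).

Lemma lion_err0 w : lion_err 0 w = (n * B0)%:R^-1 *: batch_noise 1 0 w.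
Proof.
have B0' : B0%:R != 0 :> R by rewrite pnatr_eq0 -lt0n.
rewrite /lion_err /batch_noise /= grad_f -scalerBr natrM invfM -scalerA -sumrB.
congr (_ *: _); rewrite big_allpairs_dep/= big_enum/= scaler_sumr.
apply: eq_bigr => j _; rewrite big_mkord.
rewrite (eq_bigr (fun i : 'I_B0 => G j x1 (xi 1 j i w) - gj j x1)); last first.
  by move=> i _; rewrite /vr_noise scale1r subrr scale0r addr0.
rewrite sumrB scalerBr sumr_const card_ord -[X in _ = _ - _ *: X]scaler_nat.
by rewrite scalerA mulVf// scale1r.
Qed.

(** The correction [g - h] has as its mean the change of gradient between the two iterates, which is
    exactly what carries the old momentum to the new point. No bias is left, and one identity serves
    both [v] and [m]. *)
Lemma lion_update_err b k w :
  n%:R^-1 *: (\sum_(j < n) lion_update b k w j) - grad f (lion_x k.+1 w) =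
  (1 - b) *: lion_err k w + n%:R^-1 *: batch_noise b k.+1 w.
Proof.
rewrite /lion_err /batch_noise !grad_f -!scalerBr scalerA mulrC -scalerA -scalerDr.
congr (_ *: _); rewrite big_map big_enum/= -!sumrB scaler_sumr -big_split/=.
apply: eq_bigr => j _; rewrite /lion_update /vr_noise /sample/=.
by apply/rowP => i; rewrite !mxE; ring.
Qed.

Lemma lion_errS k w :
  lion_err k.+1 w = (1 - beta2) *: lion_err k w + n%:R^-1 *: batch_noise beta2 k.+1 w.
Proof.
by rewrite -lion_update_err /lion_err; under eq_bigr do rewrite lion_mS.
Qed.

Lemma lion_dir_errS k w :
  lion_dir_err k.+1 w = (1 - beta1) *: lion_err k w + n%:R^-1 *: batch_noise beta1 k.+1 w.
Proof. by rewrite -lion_update_err. Qed.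

Hypothesis jmG : forall j i, jointly_measurable (fun x z => G j x z ord0 i).
Hypothesis lipG : forall j x y,
  (\int[D j]_z (norm2 (G j x z - G j y z) ^+ 2)%:E <= (L ^+ 2 * norm2 (x - y) ^+ 2)%:E)%E.
Hypothesis meanG : forall j x i,
  (D j).-integrable setT (fun z => (G j x z ord0 i)%:E) /\
  (\int[D j]_z (G j x z ord0 i)%:E = (gj j x ord0 i)%:E)%E.
Hypothesis varG : forall j x,
  (\int[D j]_z (norm2 (G j x z - gj j x) ^+ 2)%:E <= (sigma ^+ 2)%:E)%E.
Hypothesis mxi : forall p, used_index B0 p -> measurable_fun setT (sample p).
Hypothesis lawxi : forall p, used_index B0 p -> forall A, measurable A ->
  P (sample p @^-1` A) = D p.1.2 A.
Hypothesis indxi : mutually_independent P sample (@used_index n B0).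

Lemma gj_continuous j i : continuous (fun x => gj j x ord0 i).
Proof. exact: lipschitz_vec_continuous (gradient_lipschitz (@meanG j) (@lipG j)). Qed.

Lemma grad_f_lipschitz x y : sqnorm (grad f x - grad f y) <= L ^+ 2 * sqnorm (x - y).
Proof.
rewrite !grad_f -scalerBr -sumrB; apply: sqnorm_avg_le => // j.
exact: gradient_lipschitz (@meanG j) (@lipG j) _ _.
Qed.

(** * Measurability with respect to the samples drawn so far *)

Notation pmeas := (past_measurable sample).

Lemma past_measurable_sign s (v : Omega -> 'rV[R]_d) :
  pmeas s v -> pmeas s (fun w => sign_vec (v w)).
Proof.
move=> mv i; under eq_fun do rewrite mxE.
apply: (@measurableT_comp _ _ _ _ _ _ (@Num.sg R)) => //.
apply: nondecreasing_measurable => // a b ab.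
have [a0|a0|a0] := sgrP a; have [b0|b0|b0] := sgrP b => //; lra.
Qed.

Lemma past_measurable_oracle s p (x : Omega -> 'rV[R]_d) : p \in s ->
  pmeas s x -> pmeas s (fun w => G p.1.2 (x w) (sample p w)).
Proof.
by move=> ps mx; apply: vec_measurable_oracle => //; exact: measurable_rectangles.
Qed.

Lemma past_measurable_update b k j : pmeas (past k) (lion_x k) ->
  pmeas (past k) (lion_x k.+1) -> (forall j, pmeas (past k) (lion_m k ^~ j)) ->
  pmeas (past k.+1) (lion_update b k ^~ j).
Proof.
move=> mx mxS mm; have sub := @sub_past k.
have pin : (k.+2, j, 0%N) \in past k.+1.
  by rewrite mem_cat; apply/orP; left; apply/mapP; exists j; rewrite ?mem_enum.
have mG := past_measurable_oracle pin (past_measurable_sub sub mxS).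
have mH := past_measurable_oracle pin (past_measurable_sub sub mx).
apply: vec_measurableD; last by apply: vec_measurableZ; exact: vec_measurableB.
apply: vec_measurableD; apply: vec_measurableZ => //.
exact: past_measurable_sub sub (mm j).
Qed.

(** The next iterate is included: [x_{k+2}] uses samples up to time [k + 1] only, so it is fixed
    before the batch evaluated at it is drawn. *)
Lemma past_measurable_state k : pmeas (past k) (lion_x k) /\
  pmeas (past k) (lion_x k.+1) /\ (forall j, pmeas (past k) (lion_m k ^~ j)).
Proof.
have next s k' : pmeas s (lion_x k') -> pmeas s (lion_v k') -> pmeas s (lion_x k'.+1).
  move=> mx mv; rewrite (_ : lion_x k'.+1 = (fun w => lion_x k' w -
      eta *: (sign_vec (lion_v k' w) + lambda *: lion_x k' w))); last first.
    by apply/funext => w; rewrite lion_xS.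
  apply: vec_measurableB => //; apply: vec_measurableZ; apply: vec_measurableD.
    exact: past_measurable_sign.
  exact: vec_measurableZ.
elim: k => [|k [mx [mxS mm]]].
  have mx : pmeas (past 0) (lion_x 0) by exact: vec_measurable_cst.
  have mm j : pmeas (past 0) (lion_m 0 ^~ j).
    apply: vec_measurableZ; apply: vec_measurable_sum => i.
    apply: (@past_measurable_oracle _ (1%N, j, nat_of_ord i) (cst x1)).
      apply/allpairsP; exists (j, nat_of_ord i); split => //=.
        by rewrite mem_enum.
      by rewrite mem_index_iota ltn_ord.
    exact: vec_measurable_cst.
  split => //; split => //; apply: next => //.
  exact: vec_measurable_sum.
have mxS' := past_measurable_sub (@sub_past k) mxS.
split => //; split.
  apply: next => //; apply: vec_measurable_sum => j.
  exact: past_measurable_update.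
move=> j; rewrite (_ : lion_m k.+1 ^~ j = lion_update beta2 k ^~ j).
  exact: past_measurable_update.
by apply/funext => w; rewrite lion_mS.
Qed.

Lemma past_measurable_err k : pmeas (past k) (lion_err k).
Proof.
have [mx [_ mm]] := past_measurable_state k.
apply: vec_measurableB.
  by apply: vec_measurableZ; exact: vec_measurable_sum.
apply: (@vec_measurable_gradient _ _ (grad f)) => // i.
exact: lipschitz_vec_continuous grad_f_lipschitz.
Qed.

Lemma past_measurable_v k : pmeas (past k) (lion_v k).
Proof.
case: k => [|k].
  have [mx [_ mm]] := past_measurable_state 0.
  exact: vec_measurable_sum.
have [mx [mxS mm]] := past_measurable_state k.
by apply: vec_measurable_sum => j; exact: past_measurable_update.
Qed.

Lemma vec_measurable_lion_grad k : vec_measurable (fun w => grad f (lion_x k w)).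
Proof.
have [mx _] := past_measurable_state k.
apply: (@vec_measurable_gradient _ _ (grad f)); last first.
  by have := past_measurable_vec mxi (@past_used k) mx.
by move=> i; exact: lipschitz_vec_continuous grad_f_lipschitz.
Qed.

Lemma vec_measurable_dir_err k : vec_measurable (lion_dir_err k).
Proof.
apply: vec_measurableB; last exact: vec_measurable_lion_grad.
apply: vec_measurableZ.
by have := past_measurable_vec mxi (@past_used k) (@past_measurable_v k).
Qed.

(** * Second moments of the errors *)

Variables (W : R) (T : nat).
Hypothesis stepW : forall k w, (k < T)%N -> sqnorm (lion_x k.+1 w - lion_x k w) <= W.
Hypothesis beta2_01 : 0 <= beta2 <= 1.
Hypothesis beta1_01 : 0 <= beta1 <= 1.

(** The bound of [vr_noise_sqnorm] with [(1 - b)^2] times the squared step replaced by [W]. *)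
Definition noise_level b := 2 * b ^+ 2 * sigma ^+ 2 + 2 * L ^+ 2 * W.

(** The [n] noises, each scaled by [1 / n], contribute [noise_level b / n]: this is the gain from
    averaging over nodes. The coefficient is simplified by [(1 - b)^2 <= 1 - b]. *)
Lemma integral_update_le b k : (k.+1 < T)%N -> 0 <= b <= 1 ->
  (\int[P]_w (sqnorm ((1 - b) *: lion_err k w + n%:R^-1 *: batch_noise b k.+1 w))%:E <=
   (1 - b)%:E * \int[P]_w (sqnorm (lion_err k w))%:E + (noise_level b / n%:R)%:E)%E.
Proof.
move=> kT /andP[b0 b1]; have [mx [mxS _]] := past_measurable_state k.
have me := @past_measurable_err k.
have me' := past_measurable_vec mxi (@past_used k) me.
have := @integral_noise_sum_le _ _ _ _ _ _ _ P sample (@used_index n B0)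
  (fun p => D p.1.2) mxi lawxi indxi L sigma (fun p => G p.1.2) (fun p => gj p.1.2)
  (fun p => @jmG p.1.2) (fun p => @gj_continuous p.1.2) (fun p => @meanG p.1.2)
  (fun p => @lipG p.1.2) (fun p => @varG p.1.2)
  (past k) (batch k.+1) (fun w => (1 - b) *: lion_err k w)
  (lion_x k.+1) (lion_x k) b n%:R^-1 W (past_uniq k.+1) (@past_used k.+1)
  (vec_measurableZ (1 - b) me) mxS mx.
have hW w : (1 - b) ^+ 2 * sqnorm (lion_x k.+1 w - lion_x k w) <= W.
  have := stepW w (ltnW kT); have := sqnorm_ge0 (lion_x k.+1 w - lion_x k w).
  by move: (sqnorm _) => q; have : (1 - b) ^+ 2 <= 1; nra.
move=> /(_ hW) H; apply: le_trans; first exact: H.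
apply: leeD.
  under eq_integral do rewrite sqnormZ EFinM.
  have i0 : (0 <= \int[P]_w (sqnorm (lion_err k w))%:E)%E.
    by apply: integral_ge0 => w _; rewrite lee_fin sqnorm_ge0.
  rewrite ge0_integralZl_EFin ?sqr_ge0//.
  - by apply: lee_wpmul2r => //; rewrite lee_fin; nra.
  - by move=> w _; rewrite lee_fin sqnorm_ge0.
  - by apply/measurable_EFinP; exact: measurable_sqnorm.
rewrite lee_fin size_map size_enum_ord -/(noise_level b).
have -> : n%:R * (n%:R^-1 ^+ 2 * noise_level b) = noise_level b / n%:R.
  by field.
exact: lexx.
Qed.

(** The recursion of [integral_update_le] taken with equality; the factor 2 in the initial value is
    that of [vr_noise_sqnorm] at [b = 1]. *)
Fixpoint err_bound k :=
  if k is k'.+1 then (1 - beta2) * err_bound k' + noise_level beta2 / n%:R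
  else 2 * sigma ^+ 2 / (n * B0)%:R.

Lemma integral_err_le k : (k < T)%N ->
  (\int[P]_w (sqnorm (lion_err k w))%:E <= (err_bound k)%:E)%E.
Proof.
elim: k => [|k IH] kT.
  (* Initial batch: the past is empty, both points are the constant [x1] and [b = 1], so the drift
     bound is 0. *)
  have c0 : past_measurable sample [::] (cst 0 : Omega -> 'rV[R]_d).
    exact: vec_measurable_cst.
  have c1 : past_measurable sample [::] (cst x1 : Omega -> 'rV[R]_d).
    exact: vec_measurable_cst.
  have := @integral_noise_sum_le _ _ _ _ _ _ _ P sample (@used_index n B0)
    (fun p => D p.1.2) mxi lawxi indxi L sigma (fun p => G p.1.2) (fun p => gj p.1.2)
    (fun p => @jmG p.1.2) (fun p => @gj_continuous p.1.2) (fun p => @meanG p.1.2)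
    (fun p => @lipG p.1.2) (fun p => @varG p.1.2)
    [::] (batch 0) (cst 0) (cst x1) (cst x1) 1 (n * B0)%:R^-1 0.
  rewrite cats0 => /(_ (batch_uniq 0) (@past_used 0) c0 c1 c1).
  have h0 w : (1 - 1) ^+ 2 * sqnorm ((cst x1 : Omega -> _) w - cst x1 w) <= 0.
    by rewrite subrr expr0n mul0r.
  move=> /(_ h0) H; under eq_integral do rewrite lion_err0 -[_ *: _]add0r.
  apply: le_trans; first exact: H.
  have -> : (\int[P]_w (sqnorm ((cst 0 : Omega -> 'rV[R]_d) w))%:E = 0)%E.
    apply: integral0_eq => w _; congr EFin.
    by apply: big1 => i _; rewrite mxE expr0n.
  rewrite add0e lee_fin size_allpairs size_enum_ord size_iota subn0.
  have nB : (n * B0)%:R != 0 :> R by rewrite pnatr_eq0 -lt0n muln_gt0 n0.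
  rewrite le_eqVlt; apply/orP; left; apply/eqP.
  by rewrite /=; move: ((n * B0)%:R : R) nB => m m0; field.
under eq_integral do rewrite lion_errS.
apply: le_trans; first exact: integral_update_le.
rewrite /= [leRHS]EFinD [X in (_ <= X + _)%E]EFinM; apply: leeD2r; apply: lee_wpmul2l.
  by rewrite lee_fin; case/andP: beta2_01; lra.
exact: IH (ltnW kT).
Qed.

(** With [1 - beta1] bounded by 1, the direction error costs one noise on top of the previous
    momentum error. At [k = 0] the two errors coincide. *)
Lemma integral_dir_err_le k : (k < T)%N ->
  (\int[P]_w (sqnorm (lion_dir_err k w))%:E <=
   (err_bound k.-1 + if k is 0 then 0 else noise_level beta1 / n%:R)%:E)%E.
Proof.
case: k => [|k] kT; first by rewrite addr0; exact: integral_err_le.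
under eq_integral do rewrite lion_dir_errS.
apply: le_trans; first exact: integral_update_le.
rewrite [leRHS]EFinD; apply: leeD2r.
apply: le_trans (integral_err_le (ltnW kT)).
rewrite -[leRHS]mul1e; apply: lee_wpmul2r.
  by apply: integral_ge0 => w _; rewrite lee_fin sqnorm_ge0.
by rewrite lee_fin; case/andP: beta1_01; lra.
Qed.

Lemma noise_level_ge0 b : 0 <= W -> 0 <= noise_level b.
Proof.
by move=> W0; apply: addr_ge0; apply: mulr_ge0 => //;
  rewrite ?sqr_ge0// mulr_ge0// sqr_ge0.
Qed.

Lemma err_bound_ge0 k : 0 <= W -> 0 <= err_bound k.
Proof.
move=> W0; have nl : 0 <= noise_level beta2 / n%:R.
  by rewrite divr_ge0// noise_level_ge0.
have /andP[b0 b1] := beta2_01.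
elim: k => [|k IH] /=; first by rewrite divr_ge0// mulr_ge0// sqr_ge0.
by rewrite addr_ge0// mulr_ge0// subr_ge0.
Qed.

Lemma err_bound_sum m : 0 <= W ->
  beta2 * \sum_(0 <= k < m) err_bound k <=
  err_bound 0 + m%:R * (noise_level beta2 / n%:R).
Proof.
move=> W0.
(* Keeping [err_bound m] on the left closes the induction: each step lowers it by [beta2] times
   itself, up to the noise. *)
have : beta2 * \sum_(0 <= k < m) err_bound k + err_bound m <=
  err_bound 0 + m%:R * (noise_level beta2 / n%:R).
  elim: m => [|m IH]; first by rewrite big_geq// mulr0 add0r mul0r addr0.
  rewrite big_nat_recr// mulrDr -(natr1 m) mulrDl mul1r [err_bound m.+1]/=.
  move: IH; move: (\sum_(_ <= _ < _) _) (err_bound m) (err_bound 0) (_ / n%:R) (m%:R : R).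
  by move=> s e e0 nl m'; rewrite /=; lra.
by apply: le_trans; rewrite lerDl err_bound_ge0.
Qed.

(** * Summed descent, along a realization and in expectation *)

Hypothesis eta0 : 0 < eta.
Hypothesis lambda0 : 0 <= lambda.
Hypothesis T0 : (0 < T)%N.
Hypothesis lambdaT : 2 * (eta * lambda) * T%:R <= 1.
Hypothesis x1_eta : normInf x1 <= eta.
Variable Delta al : R.
Hypothesis f_lb : has_lbound (range f).
Hypothesis f_gap : f x1 - inf (range f) <= Delta.
Hypothesis al0 : 0 < al.

Let curv := (L ^+ 2 + 1) / 2 * (d%:R * (9 / 4 * eta ^+ 2)).

(** [descent_sum] with [c = 1 / n], divided by [eta / 2]; the objective gap is bounded through the
    infimum and the direction error through its square. *)
Lemma sum_norm1_grad_le w :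
  \sum_(0 <= k < T) norm1 (grad f (lion_x k w)) <=
  2 / eta * (Delta + T%:R * curv) + 2 * T%:R * (d%:R * al) +
  2 / al * \sum_(0 <= k < T) sqnorm (lion_dir_err k w).
Proof.
have X0 i : `|lion_x 0 w ord0 i| <= eta by exact: normInf_le.
have dff z : differentiable f z by exact: differentiable_avg.
have c0 : 0 < n%:R^-1 :> R by rewrite invr_gt0 ltr0n.
have H := @descent_sum _ _ (lion_x ^~ w) (lion_v ^~ w) eta lambda T
  (fun k => lion_xS k w) eta0 lambda0 T0 lambdaT X0 f L n%:R^-1 dff grad_f_lipschitz c0.
rewrite -/curv in H.
have gap : f (lion_x 0 w) - f (lion_x T w) <= Delta.
  apply: le_trans f_gap; rewrite lerD2l lerN2.
  by apply: ge_inf => //; exists (lion_x T w).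
have HN : \sum_(0 <= k < T) norm1 (n%:R^-1 *: lion_v k w - grad f (lion_x k w)) <=
    T%:R * (d%:R * (al / 2)) + (\sum_(0 <= k < T) sqnorm (lion_dir_err k w)) / (2 * al).
  have -> : T%:R * (d%:R * (al / 2)) = \sum_(0 <= k < T) (d%:R * (al / 2)).
    by rewrite sumr_const_nat subn0 mulr_natl.
  by rewrite mulr_suml -big_split/=; apply: ler_sum => k _; exact: norm1_le_sqnorm.
rewrite -(ler_pM2l (_ : 0 < eta / 2)); last by rewrite divr_gt0.
apply: (le_trans H).
have HN' := ler_wpM2l (_ : 0 <= 2 * eta) HN.
have E : eta / 2 * (2 / eta * (Delta + T%:R * curv) + 2 * T%:R * (d%:R * al) +
    2 / al * \sum_(0 <= k < T) sqnorm (lion_dir_err k w)) =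
  Delta + T%:R * curv + 2 * eta * (T%:R * (d%:R * (al / 2)) +
    (\sum_(0 <= k < T) sqnorm (lion_dir_err k w)) / (2 * al)).
  move: (\sum_(_ <= _ < _) _) (T%:R : R) (d%:R : R) => s t e.
  by field; rewrite !gt_eqF.
rewrite E addrAC; apply: lerD; last by apply: HN'; rewrite mulr_ge0// ltW.
by rewrite lerD2r.
Qed.

Lemma sum_integral_norm1_grad_le : 0 <= W ->
  (\sum_(0 <= k < T) \int[P]_w (norm1 (grad f (lion_x k w)))%:E <=
   (2 / eta * (Delta + T%:R * curv) + 2 * T%:R * (d%:R * al) +
    2 / al * (err_bound 0 + \sum_(0 <= k < T) err_bound k +
      T%:R * (noise_level beta1 / n%:R)))%:E)%E.
Proof.
move=> W0; set A := 2 / eta * _ + _.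
have mg k : measurable_fun setT (fun w => (norm1 (grad f (lion_x k w)))%:E).
  apply/measurable_EFinP; apply: measurable_sum => i.
  by apply: measurableT_comp => //; exact: vec_measurable_lion_grad.
have me k : measurable_fun setT (fun w => (sqnorm (lion_dir_err k w))%:E).
  by apply/measurable_EFinP; apply: measurable_sqnorm; exact: vec_measurable_dir_err.
have g0 k w : (0 <= (norm1 (grad f (lion_x k w)))%:E)%E.
  by rewrite lee_fin; apply: sumr_ge0.
have e0 k w : (0 <= (sqnorm (lion_dir_err k w))%:E)%E.
  by rewrite lee_fin sqnorm_ge0.
have A0 : 0 <= A.
  have : 0 <= f x1 - inf (range f).
    by rewrite subr_ge0; apply: ge_inf => //; exists x1.
  have c0 : 0 <= curv.
    apply: mulr_ge0; first by rewrite divr_ge0// addr_ge0// sqr_ge0.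
    by rewrite mulr_ge0// mulr_ge0// sqr_ge0.
  move=> /le_trans/(_ f_gap) D0; apply: addr_ge0; apply: mulr_ge0 => //.
  - by rewrite divr_ge0// ltW.
  - by rewrite addr_ge0// mulr_ge0.
  - by rewrite mulr_ge0// ltW.
have al2 : 0 <= 2 / al by rewrite divr_ge0// ltW.
rewrite -ge0_integral_sum//.
apply: (@le_trans _ _ (\int[P]_w (A%:E +
    (2 / al)%:E * \sum_(0 <= k < T) (sqnorm (lion_dir_err k w))%:E))%E).
  apply: ge0_le_integral => //.
  - by move=> w _; exact: sume_ge0.
  - exact: emeasurable_sum.
  - apply: emeasurable_funD; first exact: measurable_cst.
    by apply: measurable_funeM; exact: emeasurable_sum.
  - move=> w _; rewrite !sumEFin -EFinM -EFinD lee_fin.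
    exact: sum_norm1_grad_le.
rewrite ge0_integralD//; last first.
- by apply: measurable_funeM; exact: emeasurable_sum.
- by move=> w _; rewrite mule_ge0// sume_ge0.
rewrite [leRHS]EFinD; apply: leeD.
  rewrite integral_cst// -[leRHS]mule1; apply: lee_wpmul2l => //.
  by rewrite le_eqVlt; apply/orP; left; apply/eqP; exact: probability_setT.
rewrite ge0_integralZl_EFin//; last first.
- exact: emeasurable_sum.
- by move=> w _; exact: sume_ge0.
rewrite [leRHS]EFinM; apply: lee_wpmul2l => //.
rewrite ge0_integral_sum//.
(* The direction errors at [k = 0] and [k = 1] both involve [err_bound 0], hence its extra copy in
   the statement. *)
apply: (@le_trans _ _ (\sum_(0 <= k < T) (err_bound k.-1 +
    if k is 0 then 0 else noise_level beta1 / n%:R)%:E)%E).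
  rewrite big_nat_cond [leRHS]big_nat_cond; apply: lee_sum => k.
  by rewrite andbT => /andP[_ kT]; exact: integral_dir_err_le.
rewrite sumEFin lee_fin.
have nl0 : 0 <= noise_level beta1 / n%:R by rewrite divr_ge0// noise_level_ge0.
case: T T0 => [//|t] _.
rewrite big_nat_recl//= addr0 -addrA lerD2l.
rewrite (eq_bigr (fun k => err_bound k + noise_level beta1 / n%:R))//.
rewrite big_split/= sumr_const_nat subn0 big_nat_recr//= -(mulr_natl (_ / _) t).
rewrite -(natr1 t).
have := @err_bound_ge0 t W0.
move: nl0; move: (_ / n%:R) (\sum_(_ <= _ < _) _) (err_bound t) (t%:R : R) => *; nra.
Qed.

End lion.

(** * The rate *)

Section rate.
Context {R : realType}.

(** With cube roots as variables, the powers of [n] and [T] in the rate become rational expressions,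
    within reach of [field]. *)
Lemma powR_third (x : R) : 0 < x ->
  [/\ 0 < x `^ (1 / 3), (x `^ (1 / 3)) ^+ 3 = x &
      x `^ (- (2 / 3)) = ((x `^ (1 / 3)) ^+ 2)^-1].
Proof.
move=> x0; have a0 : 0 < x `^ (1 / 3) by exact: powR_gt0.
split => //.
  rewrite -powR_mulrn ?ltW// -powRrM (_ : 1 / 3 * 3%:R = 1 :> R); last by field.
  by rewrite powRr1// ltW.
rewrite powRN -[(x `^ (1 / 3)) ^+ 2]powR_mulrn ?ltW// -powRrM.
by congr (_ `^ _)^-1; field.
Qed.

Lemma powR_half (x : R) : 0 < x ->
  [/\ 0 < x `^ (1 / 2), (x `^ (1 / 2)) ^+ 2 = x &
      x `^ (- (1 / 2)) = (x `^ (1 / 2))^-1].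
Proof.
move=> x0; have a0 : 0 < x `^ (1 / 2) by exact: powR_gt0.
split => //; last by rewrite powRN.
rewrite -powR_mulrn ?ltW// -powRrM (_ : 1 / 2 * 2%:R = 1 :> R); last by field.
by rewrite powRr1// ltW.
Qed.

(** Equal to [2 * K1 + 2 * K2] in [rate_arith]: the initial batch, then the sampling and drift
    noises. *)
Definition lion_variance_cst (s2 L2 cbeta ceta cB : R) :=
  4 * s2 / (cB * cbeta) + 2 * (2 * s2 * cbeta + 9 / 2 * L2 * ceta ^+ 2 / cbeta).

(** In order: initial gap, curvature, the part linear in [al], variance. *)
Definition lion_rate_cst (s2 L2 Delta cbeta ceta cB : R) :=
  2 * Delta / ceta + (L2 + 1) * (9 / 4) * ceta + 2 +
  2 * lion_variance_cst s2 L2 cbeta ceta cB.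

(* a, b, q stand for n^(1/3), T^(1/3), d^(1/2), and b1sq for beta1^2. *)
Lemma rate_arith (a b q s2 L2 Delta cbeta ceta cB B S b1sq eta beta2 W r0 al : R) :
  0 < a -> 0 < b -> 0 < q -> a ^+ 2 <= b -> beta2 <= 1 ->
  0 < cbeta -> 0 < ceta -> 0 < cB -> 0 <= s2 -> 0 <= L2 ->
  cB * b / a ^+ 2 <= B -> b1sq <= beta2 ->
  eta = ceta * a / (q * b ^+ 2) -> beta2 = cbeta * a / b ^+ 2 ->
  W = q ^+ 2 * (9 / 4 * eta ^+ 2) -> r0 = 2 * s2 / (a ^+ 3 * B) ->
  al = (q * a * b)^-1 ->
  beta2 * S <= r0 + b ^+ 3 * ((2 * beta2 ^+ 2 * s2 + 2 * L2 * W) / a ^+ 3) ->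
  (b ^+ 3)^-1 * (2 / eta * (Delta + b ^+ 3 * ((L2 + 1) / 2 * W)) +
    2 * b ^+ 3 * (q ^+ 2 * al) +
    2 / al * (r0 + S + b ^+ 3 * ((2 * b1sq * s2 + 2 * L2 * W) / a ^+ 3))) <=
  lion_rate_cst s2 L2 Delta cbeta ceta cB * q / (a * b).
Proof.
move=> a0 b0 q0 ab b21 cb0 ce0 cB0 s20 L20 hB hb1 etaE beta2E WE r0E alE hS.
have na : a != 0 by rewrite gt_eqF.
have nb : b != 0 by rewrite gt_eqF.
have nq : q != 0 by rewrite gt_eqF.
have ncb : cbeta != 0 by rewrite gt_eqF.
have nce : ceta != 0 by rewrite gt_eqF.
have ncB : cB != 0 by rewrite gt_eqF.
have WE' : W = 9 / 4 * ceta ^+ 2 * a ^+ 2 / b ^+ 4 by rewrite WE etaE; field; rewrite nq nb.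
have W0 : 0 <= W by rewrite WE' !mulr_ge0// ?invr_ge0 ?exprn_ge0// ltW.
have b20 : 0 < beta2 by rewrite beta2E divr_gt0 ?mulr_gt0 ?exprn_gt0.
(* The common scale [T^(1/3) / n^(2/3)] of the batch size and of the squared errors summed over
   time. *)
pose u := b / a ^+ 2.
have u0 : 0 < u by rewrite divr_gt0// exprn_gt0.
pose K1 := 2 * s2 / (cB * cbeta).
pose K2 := 2 * s2 * cbeta + 9 / 2 * L2 * ceta ^+ 2 / cbeta.
have K10 : 0 <= K1 by rewrite divr_ge0 ?mulr_ge0// ltW.
have Bpos : 0 < cB * b / a ^+ 2 by rewrite divr_gt0 ?mulr_gt0 ?exprn_gt0.
(* The batch is large enough for the initial error to stay of order [u] after division by
   [beta2]. *)
have r0le : r0 <= beta2 * (K1 * u).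
  have -> : beta2 * (K1 * u) = 2 * s2 / (a ^+ 3 * (cB * b / a ^+ 2)).
    by rewrite beta2E /K1 /u; field; rewrite na nb ncb ncB.
  have B_gt0 : 0 < B by exact: lt_le_trans hB.
  rewrite r0E ler_wpM2l ?mulr_ge0// lef_pV2 ?posrE; last 2 first.
  - by rewrite mulr_gt0// exprn_gt0.
  - by rewrite mulr_gt0// exprn_gt0.
  by rewrite ler_pM2l// exprn_gt0.
have E2 : b ^+ 3 * ((2 * beta2 ^+ 2 * s2 + 2 * L2 * W) / a ^+ 3) = beta2 * (K2 * u).
  by rewrite beta2E WE' /K2 /u; field; rewrite na nb ncb.
have Sle : S <= K1 * u + K2 * u.
  rewrite -(ler_pM2l b20) mulrDr; apply: (le_trans hS); rewrite E2.
  by apply: lerD; first exact: r0le.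
have r0le' : r0 <= K1 * u.
  by apply: (le_trans r0le); rewrite ler_piMl// mulr_ge0// ltW.
(* [beta1^2 <= beta2] and [W <= W / beta2] place the direction noise under the constant already
   found for the momentum. *)
have N1le : b ^+ 3 * ((2 * b1sq * s2 + 2 * L2 * W) / a ^+ 3) <= K2 * u.
  have -> : K2 * u = b ^+ 3 * ((2 * beta2 * s2 + 2 * L2 * (W / beta2)) / a ^+ 3).
    by rewrite beta2E WE' /K2 /u; field; rewrite na nb ncb.
  have Wb : W <= W / beta2 by rewrite ler_peMr// invf_ge1.
  rewrite ler_wpM2l ?exprn_ge0 ?(ltW b0)// ler_wpM2r ?invr_ge0 ?exprn_ge0 ?(ltW a0)//.
  by apply: lerD; [rewrite ler_wpM2r// ler_wpM2l|rewrite ler_wpM2l// mulr_ge0].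
have al0 : 0 < 2 / al by rewrite divr_gt0// alE invr_gt0 !mulr_gt0.
have tot : 2 / al * (r0 + S + b ^+ 3 * ((2 * b1sq * s2 + 2 * L2 * W) / a ^+ 3)) <=
    2 / al * ((2 * K1 + 2 * K2) * u).
  by rewrite ler_pM2l//; lra.
(* The curvature carries a spare factor [a^2 / b], which is at most 1 by [ab]. *)
have curv_le : 2 / eta * (b ^+ 3 * ((L2 + 1) / 2 * W)) <=
    b ^+ 3 * ((L2 + 1) * (9 / 4) * ceta * q / (a * b)).
  have -> : 2 / eta * (b ^+ 3 * ((L2 + 1) / 2 * W)) =
      b ^+ 3 * ((L2 + 1) * (9 / 4) * ceta * q / (a * b)) * (a ^+ 2 / b).
    by rewrite etaE WE'; field; rewrite na nb nq nce.
  rewrite ler_piMr ?ler_pdivrMr ?mul1r//.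
  by rewrite !mulr_ge0 ?exprn_ge0 ?invr_ge0 ?mulr_ge0 ?addr_ge0// ltW.
rewrite mulrC ler_pdivrMr ?exprn_gt0// mulrDr.
have -> : lion_rate_cst s2 L2 Delta cbeta ceta cB * q / (a * b) * b ^+ 3 =
    2 / eta * Delta + b ^+ 3 * ((L2 + 1) * (9 / 4) * ceta * q / (a * b)) +
    2 * b ^+ 3 * (q ^+ 2 * al) + 2 / al * ((2 * K1 + 2 * K2) * u).
  rewrite /lion_rate_cst /lion_variance_cst /K1 /K2 /u alE etaE.
  by field; rewrite na nb nq nce ncb ncB.
by apply: lerD => //; apply: lerD => //; apply: lerD.
Qed.

End rate.

Theorem theorem4 (R : realType) (L sigma Delta cbeta ceta cB : R) :
  0 < cbeta <= 1 -> 0 < ceta -> 0 < cB ->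
  exists C : R,
  forall (n d T : nat)
    (dO : measure_display) (Omega : measurableType dO) (P : probability Omega R)
    (dX : measure_display) (Xi : measurableType dX) (D : 'I_n -> probability Xi R)
    (fj : 'I_n -> 'rV[R]_d -> R) (G : 'I_n -> 'rV[R]_d -> Xi -> 'rV[R]_d)
    (xi : nat -> 'I_n -> nat -> Omega -> Xi)
    (x1 : 'rV[R]_d) (beta1 beta2 eta lambda : R) (B0 : nat),
    let f := fun x => (n%:R)^-1 * \sum_(j < n) fj j x in
    (0 < n)%N -> (0 < d)%N ->
    (* the stochastic gradient oracle is jointly measurable *)
    (forall j i, jointly_measurable (fun x z => G j x z ord0 i)) ->
    (* each f_j is differentiable *)
    (forall j x, differentiable (fj j) x) ->
    (* (D2) *)
    (forall j x y,
       (\int[D j]_z ((norm2 (G j x z - G j y z)) ^+ 2)%:E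
        <= (L ^+ 2 * (norm2 (x - y)) ^+ 2)%:E)%E) ->
    (* (D3) unbiasedness *)
    (forall j x i,
       (D j).-integrable setT (fun z => (G j x z ord0 i)%:E) /\
       (\int[D j]_z (G j x z ord0 i)%:E = (grad (fj j) x ord0 i)%:E)%E) ->
    (* (D3) bounded variance *)
    (forall j x,
       (\int[D j]_z ((norm2 (G j x z - grad (fj j) x)) ^+ 2)%:E
        <= (sigma ^+ 2)%:E)%E) ->
    (* (D4) *)
    has_lbound (range f) -> f x1 - inf (range f) <= Delta ->
    (* samples: measurable, distributed as D_j, mutually independent *)
    (forall k, @used_index n B0 k -> measurable_fun setT (xi k.1.1 k.1.2 k.2)) ->
    (forall k, @used_index n B0 k -> forall A, measurable A ->
       P (xi k.1.1 k.1.2 k.2 @^-1` A) = D k.1.2 A) ->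
    mutually_independent P (fun k : nat * 'I_n * nat => xi k.1.1 k.1.2 k.2)
      (@used_index n B0) ->
    (* parameters *)
    (n ^ 2 <= T)%N ->
    (B0%:R : R) = (Num.ceil (cB * n%:R `^ (- (2 / 3)) * T%:R `^ (1 / 3)))%:~R ->
    (1 <= B0)%N ->
    beta2 = cbeta * n%:R `^ (1 / 3) * T%:R `^ (- (2 / 3)) ->
    0 < beta1 <= Num.sqrt beta2 ->
    eta = ceta * n%:R `^ (1 / 3) * d%:R `^ (- (1 / 2)) * T%:R `^ (- (2 / 3)) ->
    0 <= lambda <= (2 * eta * T%:R)^-1 ->
    normInf x1 <= eta ->
    ((T%:R)^-1%:E *
       \sum_(1 <= t < T.+1)
         \int[P]_w (norm1 (grad f
           (lion_iterate G (fun t j i => xi t j i w) x1 beta1 beta2 eta lambda B0 t)))%:E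
     <= (C * d%:R `^ (1 / 2) / (n%:R `^ (1 / 3) * T%:R `^ (1 / 3)))%:E)%E.
Proof.
move=> /andP[cb0 cb1] ce0 cB0.
exists (lion_rate_cst (sigma ^+ 2) (L ^+ 2) Delta cbeta ceta cB).
move=> n d T dO Omega P dX Xi D fj G xi x1 beta1 beta2 eta lambda B0 f n0 d0 jmG df
  lipG meanG varG f_lb f_gap mxi lawxi indxi nT B0E B0_gt0 beta2E /andP[b10 b1le] etaE
  /andP[lam0 lamle] x1_eta.
have T0 : (0 < T)%N by apply: leq_trans nT; rewrite expn_gt0 n0.
have n0R : 0 < n%:R :> R by rewrite ltr0n.
have T0R : 0 < T%:R :> R by rewrite ltr0n.
have d0R : 0 < d%:R :> R by rewrite ltr0n.
have [a0 a3 aN] := powR_third n0R; have [b0 b3 bN] := powR_third T0R.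
have [q0 q2 qN] := powR_half d0R.
rewrite aN in B0E; rewrite bN in beta2E etaE; rewrite qN in etaE.
move: a0 a3 b0 b3 q0 q2 B0E beta2E etaE {aN bN qN}.
set a := n%:R `^ (1 / 3); set b := T%:R `^ (1 / 3); set q := d%:R `^ (1 / 2).
move=> a0 a3 b0 b3 q0 q2 B0E beta2E etaE.
have a1 : 1 <= a.
  rewrite leNgt; apply/negP => a1; have : a ^+ 3 < 1 by rewrite exprn_ilt1// ltW.
  by rewrite a3 ltNge ler1n n0.
(* Cubed, this is [n^2 <= T]. *)
have ab : a ^+ 2 <= b.
  rewrite -(@ler_pXn2r _ 3)// ?nnegrE ?exprn_ge0 ?(ltW a0) ?(ltW b0)// b3 -exprM mulnC exprM a3.
  by rewrite -natrX ler_nat.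
have beta2E' : beta2 = cbeta * a / b ^+ 2 by [].
have b20 : 0 < beta2 by rewrite beta2E' divr_gt0 ?mulr_gt0 ?exprn_gt0.
(* From [cbeta * a <= a <= a^4 <= b^2], as [a >= 1]. *)
have b21 : beta2 <= 1.
  rewrite beta2E' ler_pdivrMr ?exprn_gt0// mul1r.
  have : cbeta * a <= a by rewrite ler_piMl// ltW.
  by nra.
have b1sq : beta1 ^+ 2 <= beta2.
  by rewrite -[leRHS]sqr_sqrtr ?(ltW b20)// ler_pXn2r// ?nnegrE ?sqrtr_ge0 ?(ltW b10).
have b11 : beta1 <= 1.
  by rewrite -[1]sqrtr1; apply: (le_trans b1le); rewrite ler_sqrt.
have etaE' : eta = ceta * a / (q * b ^+ 2).
  by rewrite etaE; field; rewrite !gt_eqF.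
have eta0 : 0 < eta by rewrite etaE' divr_gt0 ?mulr_gt0 ?exprn_gt0.
have lamT : 2 * (eta * lambda) * T%:R <= 1.
  have : 0 < 2 * eta * T%:R by rewrite !mulr_gt0.
  move=> h; have := ler_wpM2l (ltW h) lamle; rewrite mulfV ?gt_eqF//.
  by apply: le_trans; rewrite le_eqVlt; apply/orP; left; apply/eqP; ring.
pose W := d%:R * (9 / 4 * eta ^+ 2).
have W0 : 0 <= W by rewrite mulr_ge0// mulr_ge0// sqr_ge0.
(* This weight balances [T d al] against [T^(1/3) n^(-2/3) / al]: both are of order
   [d^(1/2) T^(2/3) n^(-1/3)]. *)
pose al := (q * a * b)^-1.
have al0 : 0 < al by rewrite invr_gt0 !mulr_gt0.
have stepW k w : (k < T)%N -> sqnorm (lion_x G xi x1 beta1 beta2 eta lambda B0 k.+1 w -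
    lion_x G xi x1 beta1 beta2 eta lambda B0 k w) <= W.
  move=> kT; apply: (@sqnorm_step_bound R d (lion_x G xi x1 beta1 beta2 eta lambda B0 ^~ w)
    (lion_v G xi x1 beta1 beta2 eta lambda B0 ^~ w) eta lambda T) => // [k'|i].
    exact: lion_xS.
  exact: normInf_le.
have b201 : 0 <= beta2 <= 1 by rewrite ltW.
have b101 : 0 <= beta1 <= 1 by rewrite ltW.
have H := sum_integral_norm1_grad_le n0 B0_gt0 df jmG lipG meanG varG mxi lawxi indxi
  stepW b201 b101 eta0 lam0 T0 lamT x1_eta f_lb f_gap al0 W0.
(* The shift [t = k + 1] identifies [lion_iterate] at time [t], read off the state [t.-1], with
   [lion_x k]. *)
rewrite big_add1/=.
apply: le_trans; first by apply: lee_wpmul2l H; rewrite lee_fin invr_ge0 ltW.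
rewrite -EFinM lee_fin.
have sumS := @err_bound_sum R n beta2 L sigma B0 W b201 T W0.
have r0E : @err_bound R n beta2 L sigma B0 W 0 = 2 * sigma ^+ 2 / (a ^+ 3 * B0%:R).
  by rewrite a3 -natrM.
have WE : W = q ^+ 2 * (9 / 4 * eta ^+ 2) by rewrite q2.
have hB : cB * b / a ^+ 2 <= B0%:R.
  by rewrite B0E mulrAC; exact: ceil_ge.
move: sumS; rewrite -[d%:R * (9 / 4 * _)]/W /noise_level -b3 -a3 -q2.
move: (\sum_(0 <= k < T) _) => S sumS.
exact: (rate_arith Delta a0 b0 q0 ab b21 cb0 ce0 cB0 (sqr_ge0 _) (sqr_ge0 _) hB b1sq etaE'
  beta2E' WE r0E erefl sumS).
Qed.
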